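(* Assume CH, and let $M$ be an $\omega_1$-saturated non-standard model of true arithmetic of cardinality $\omega_1$, and $\Omega\in M$ a non-standard number. Then the Maharam type of $\mathcal{B}_{M,\Omega}$ is $\omega_1$, i.e. $\tau(\mathcal{B}_{M,\Omega})=\omega_1$. Consequently $\mathcal{B}_{M,\Omega}$ is isomorphic as a measure algebra to $\mathcal{B}_{\omega_1}$.
   Context: $\Omega$ is identified with $\{x\in M:x<\Omega\}$; $\mathcal{A}_{M,\Omega}$ is the Boolean algebra of subsets of $\Omega$ coded by elements of $M$, $|A|$ the $M$-cardinality of $A$, $\mu_{M,\Omega}(A)=\mathrm{st}(|A|/|\Omega|)$ the standard part of the $M$-rational $|A|/|\Omega|$, $I_{M,\Omega}$ the ideal of measure-zero sets, and $\mathcal{B}_{M,\Omega}=\mathcal{A}_{M,\Omega}/I_{M,\Omega}$ with measure $\mu_{M,\Omega}([A])=\mu_{M,\Omega}(A)$ (a probability measure algebra). The Maharam type $\tau(\mathcal{B})$ of a measure algebra is the least cardinality of a set completely generating it (closing under arbitrary suprema and infima). For an infinite cardinal $\kappa$, $\mathcal{B}_\kappa$ is the measure algebra $\Sigma_\kappa/\mathcal{N}$, where $\Sigma_\kappa$ is the $\sigma$-algebra on $2^\kappa$ generated by the sets $S_t=\{f\in2^\kappa:t\subseteq f\}$ for finite partial functions $t:\kappa\to2$, $\lambda_\kappa$ is the product measure with $\lambda_\kappa(S_t)=2^{-|t|}$, $\mathcal{N}$ the null sets, and the measure on the quotient is induced by $\lambda_\kappa$. An isomorphism of measure algebras is a Boolean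 isomorphism preserving the measure exactly. *)

(* Defs.v *)
From HB Require Import structures.
From mathcomp Require Import all_boot all_order all_algebra finmap.
From mathcomp Require Import mathcomp_extra boolp classical_sets functions.
From mathcomp Require Import cardinality wochoice reals ereal measure.

Set Implicit Arguments.
Unset Strict Implicit.
Unset Printing Implicit Defensive.
Import Order.TTheory GRing.Theory Num.Theory.
Local Open Scope classical_set_scope.
Local Open Scope card_scope.

(** * The cardinal omega_1 *)

(* In a well-ordering of 2^omega, the points with countably many predecessors
   form an initial segment of order type omega_1; see [omega1P]. *)
Definition reals_wo : rel (nat -> bool) :=
  sval (well_ordering_principle (nat -> bool)).

Definition omega1_set : set (nat -> bool) :=
  [set x | countable [set y | reals_wo y x]].

Definition omega1 : choiceType := set_type omega1_set.

Definition omega1_le (x y : omega1) : bool := reals_wo (val x) (val y).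

Lemma uncountable_reals : ~ countable [set: nat -> bool].
Proof.
move=> /countable_injP[g g_inj].
pose d n := `[< exists2 x : nat -> bool, g x = n & ~~ x n >].
case: (boolP (d (g d))) => [/[dup] dd /asboolP[x gx]|dd].
  by have -> : x = d; [apply: g_inj; rewrite ?inE | rewrite dd].
by move: (dd); rewrite {1}/d => /asboolP; apply; exists d.
Qed.

Lemma omega1P : [/\ well_order omega1_le, ~ countable [set: omega1] &
  forall x, countable [set y | omega1_le y x]].
Proof.
have wo : well_order reals_wo := svalP (well_ordering_principle _).
have woT : wo_chain reals_wo predT by move=> A _; exact: wo.
have le_total x y : reals_wo x y || reals_wo y x by apply: (wo_chainW woT).
have le_anti x y : reals_wo x y -> reals_wo y x -> x = y.
  by move=> xy yx; apply: (wo_chain_antisymmetric woT) => //; rewrite xy yx.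
have countable_omega1 (A : set omega1) : countable (val @` A) -> countable A.
  by rewrite (eq_countable (inj_card_eq _)) // => u v _ _; apply: val_inj.
split.
- apply: antisymmetric_well_order.
    by move=> x y /andP[xy yx]; apply/val_inj/le_anti.
  move=> A [x Ax].
  have [|z [[Az minz] _]] := wo (mem [set val y | y in [set` A]]).
    by exists (val x); rewrite inE; exists x.
  move: Az; rewrite inE => -[y Ay yz]; exists y; split=> // u Au.
  by rewrite /omega1_le yz; apply: minz; rewrite inE; exists u.
- move=> cO.
  have cD : countable omega1_set.
    have -> : omega1_set = val @` [set: omega1].
      apply/seteqP; split=> [x Dx|_ [x _ <-]]; last exact: set_valP.
      by exists (SigSub (mem_set Dx)).
    exact: sub_countable (card_image_le _ _) cO.
  have [x Dx] : exists x, x \in mem (~` omega1_set).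
    apply: contrapT => /forallNP nD; apply: uncountable_reals.
    apply: sub_countable cD; apply: subset_card_le => x _.
    by apply: contrapT => /mem_set/nD.
  have [z [[Dz minz] _]] := wo _ (ex_intro _ x Dx).
  move: Dz; rewrite inE; apply; rewrite /omega1_set/=.
  apply: (@sub_countable _ _ _ (omega1_set `|` [set z])).
    apply: subset_card_le => y /= yz; apply: contrapT => /not_orP[nDy yNz].
    by apply: yNz; apply: le_anti => //; apply: minz; rewrite inE.
  by rewrite -bigcup2E; apply: bigcup_countable => // -[|[|i]] _ /=.
move=> x; apply: countable_omega1.
apply: sub_countable (set_valP x); apply: subset_card_le.
by move=> _ [y /= yx <-].
Qed.

Definition CH : Prop := [set: nat -> bool] #= [set: omega1].

(** * First-order arithmetic, in the language 0, 1, +, *, < *)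

Record arith_structure := ArithStructure {
  carrier :> choiceType;
  azero : carrier;
  aone : carrier;
  aadd : carrier -> carrier -> carrier;
  amul : carrier -> carrier -> carrier;
  alt : carrier -> carrier -> Prop }.

Definition standard_model : arith_structure :=
  @ArithStructure nat 0 1 addn muln (fun x y => (x < y)%N).

(* Variables are de Bruijn indices: a quantifier binds index 0 of its body. *)
Inductive aterm : Type :=
  | TVar of nat
  | TZero
  | TOne
  | TAdd of aterm & aterm
  | TMul of aterm & aterm.

Inductive aformula : Type :=
  | FEq of aterm & aterm
  | FLt of aterm & aterm
  | FFalse
  | FImp of aformula & aformula
  | FAnd of aformula & aformula
  | FOr of aformula & aformula
  | FAll of aformula
  | FEx of aformula.

Fixpoint term_vars_below (n : nat) (t : aterm) : bool :=
  match t with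
  | TVar i => (i < n)%N
  | TZero | TOne => true
  | TAdd t1 t2 | TMul t1 t2 => term_vars_below n t1 && term_vars_below n t2
  end.

Fixpoint free_vars_below (n : nat) (p : aformula) : bool :=
  match p with
  | FEq t1 t2 | FLt t1 t2 => term_vars_below n t1 && term_vars_below n t2
  | FFalse => true
  | FImp p1 p2 | FAnd p1 p2 | FOr p1 p2 =>
      free_vars_below n p1 && free_vars_below n p2
  | FAll q | FEx q => free_vars_below n.+1 q
  end.

Definition sentence (p : aformula) : bool := free_vars_below 0 p.

Definition scons (T : Type) (x : T) (e : nat -> T) (n : nat) : T :=
  if n is k.+1 then e k else x.

Fixpoint teval (M : arith_structure) (e : nat -> M) (t : aterm) : M :=
  match t with
  | TVar i => e i
  | TZero => azero M
  | TOne => aone M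
  | TAdd t1 t2 => aadd (teval e t1) (teval e t2)
  | TMul t1 t2 => amul (teval e t1) (teval e t2)
  end.

Fixpoint sat (M : arith_structure) (e : nat -> M) (p : aformula) : Prop :=
  match p with
  | FEq t1 t2 => teval e t1 = teval e t2
  | FLt t1 t2 => alt (teval e t1) (teval e t2)
  | FFalse => False
  | FImp p1 p2 => sat e p1 -> sat e p2
  | FAnd p1 p2 => sat e p1 /\ sat e p2
  | FOr p1 p2 => sat e p1 \/ sat e p2
  | FAll q => forall x : M, sat (scons x e) q
  | FEx q => exists x : M, sat (scons x e) q
  end.

Definition models (M : arith_structure) (p : aformula) : Prop :=
  forall e : nat -> M, sat e p.

Definition true_arithmetic : set aformula :=
  [set p | sentence p /\ models standard_model p].

Definition model_of_true_arithmetic (M : arith_structure) : Prop :=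
  forall p, true_arithmetic p -> models M p.

(* The environment [e] lists the countably many parameters of the 1-type
   [Gamma]: index 0 is the variable of the type, index k.+1 names [e k]. *)
Definition omega1_saturated (M : arith_structure) : Prop :=
  forall (e : nat -> M) (Gamma : set aformula),
    (forall D : set aformula, finite_set D -> D `<=` Gamma ->
      exists x : M, forall p, D p -> sat (scons x e) p) ->
    exists x : M, forall p, Gamma p -> sat (scons x e) p.

Section Arithmetic.
Variable M : arith_structure.

Fixpoint numeral (n : nat) : M :=
  if n is k.+1 then aadd (numeral k) (aone M) else azero M.

Definition nonstandard (x : M) : Prop := forall n : nat, x <> numeral n.

Definition nonstandard_model : Prop := exists x : M, nonstandard x.

Definition below (x : M) : set M := [set y | alt y x].

Definition ale (x y : M) : Prop := alt x y \/ x = y.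

(* Goedel's beta function: [y] is the remainder of [a] by [1 + (1 + x) b]. *)
Definition beta (a b x y : M) : Prop :=
  let d := aadd (aone M) (amul (aadd (aone M) x) b) in
  alt y d /\ exists q : M, a = aadd (amul q d) y.

(* The Boolean algebra A_{M,Omega}. Every M-finite set is coded through the
   zeros of some beta function, so any of the usual codings of finite sets by
   numbers yields the same subsets of Omega. *)
Definition coded_subsets (Omega : M) : set (set M) :=
  [set A | exists a b : M,
     A = [set x | below Omega x /\ beta a b x (azero M)]].

(* M contains a code of a bijection of A onto {y | y < n}. *)
Definition has_internal_card (A : set M) (n : M) : Prop :=
  exists (a b : M) (f : M -> M),
    (forall x, A x -> beta a b x (f x)) /\ set_bij A (below n) f.

Definition internal_card (A : set M) : M :=
  xget (azero M) [set n | has_internal_card A n].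

End Arithmetic.

(* The standard part of the nonnegative M-rational p / q: the supremum of the
   standard rationals m / n below it. *)
Definition st_ratio (R : realType) (M : arith_structure) (p q : M) : R :=
  sup [set r : R | exists m n : nat, [/\ (0 < n)%N,
    ale (amul (numeral M m) q) (amul (numeral M n) p) &
    r = (m%:R / n%:R)%R]].

Definition internal_measure (R : realType) (M : arith_structure) (Omega : M)
    (A : set M) : R :=
  st_ratio R (internal_card A) (internal_card (below Omega)).

(** * Measure algebras *)

(* Boolean operations together with a real-valued measure. The elements of the
   algebra are the members of [elts]; the operations are irrelevant outside
   [elts]. *)
Record measured_algebra (R : realType) := MeasuredAlgebra {
  ambient : Type;
  elts : set ambient;
  bjoin : ambient -> ambient -> ambient;
  bmeet : ambient -> ambient -> ambient;
  bcompl : ambient -> ambient;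
  mass : ambient -> R }.

Section Quotient.
Variables (R : realType) (X : Type).
(* [F] is a Boolean algebra of subsets of [top] and [mu] a finitely additive
   measure on it. *)
Variables (top : set X) (F : set (set X)) (mu : set X -> R).

(* [A] modulo the ideal of null sets *)
Definition null_class (A : set X) : set (set X) :=
  [set B | F B /\ mu (A `+` B) = 0%R].

(* In [bjoin], [bmeet] and [bcompl] the unions are over representatives; all of
   these give the same class, which is therefore the union. *)
Definition null_quotient : measured_algebra R :=
  {| ambient := set (set X);
     elts := null_class @` F;
     bjoin := fun a b => \bigcup_(A in a) \bigcup_(B in b) null_class (A `|` B);
     bmeet := fun a b => \bigcup_(A in a) \bigcup_(B in b) null_class (A `&` B);
     bcompl := fun a => \bigcup_(A in a) null_class (top `\` A);
     mass := fun a => xget 0%R (mu @` a) |}.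

End Quotient.

Section MeasuredAlgebra.
Variables (R : realType) (B : measured_algebra R).

Definition ble (x y : ambient B) : Prop := bmeet x y = x.

Definition is_bsup (S : set (ambient B)) (s : ambient B) : Prop :=
  [/\ elts s, (forall x, S x -> ble x s) &
      forall u, elts u -> (forall x, S x -> ble x u) -> ble s u].

Definition is_binf (S : set (ambient B)) (s : ambient B) : Prop :=
  [/\ elts s, (forall x, S x -> ble s x) &
      forall u, elts u -> (forall x, S x -> ble u x) -> ble u s].

Definition complete_subalgebra (C : set (ambient B)) : Prop :=
  [/\ C `<=` @elts R B,
      (forall x, C x -> C (bcompl x)),
      (forall S s, S `<=` C -> is_bsup S s -> C s) &
      (forall S s, S `<=` C -> is_binf S s -> C s)].

Definition completely_generates (G : set (ambient B)) : Prop :=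
  G `<=` @elts R B /\
  forall C, complete_subalgebra C -> G `<=` C -> @elts R B `<=` C.

(* The least cardinality of a completely generating set is that of [K]. *)
Definition maharam_type_is (K : Type) : Prop :=
  (exists G, completely_generates G /\ G #= [set: K]) /\
  (forall G, completely_generates G -> [set: K] #<= G).

End MeasuredAlgebra.

Definition measure_algebra_isomorphic (R : realType)
    (B1 B2 : measured_algebra R) : Prop :=
  exists phi : ambient B1 -> ambient B2,
    [/\ set_bij (@elts R B1) (@elts R B2) phi,
        (forall x y, elts x -> elts y ->
           phi (bjoin x y) = bjoin (phi x) (phi y)),
        (forall x y, elts x -> elts y ->
           phi (bmeet x y) = bmeet (phi x) (phi y)),
        (forall x, elts x -> phi (bcompl x) = bcompl (phi x)) &
        (forall x, elts x -> mass (phi x) = mass x)].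

(* The measure algebra B_{M,Omega} *)
Definition model_algebra (R : realType) (M : arith_structure) (Omega : M) :
    measured_algebra R :=
  null_quotient (below Omega) (coded_subsets Omega)
    (internal_measure R Omega).

Section Cantor.
Variables (R : realType) (K : choiceType).

Definition cylinder (t : {fmap K -> bool}) : set (K -> bool) :=
  [set f | forall k b, t.[? k]%fmap = Some b -> f k = b].

(* 2^K with the sigma-algebra Sigma_K *)
Definition cantor_space := g_sigma_algebraType (range cylinder).

(* The probability measure on Sigma_K with these values on cylinders; it
   exists, and is unique because cylinders form a pi-system. *)
Definition product_measure : probability cantor_space R :=
  @xget (probability cantor_space R) (dirac (point : cantor_space))
    [set lam : probability cantor_space R |
      forall t : {fmap K -> bool},
        lam (cylinder t) = ((2^-1 : R) ^+ #|` domf t|)%:E].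

(* The measure algebra B_K *)
Definition cantor_algebra : measured_algebra R :=
  null_quotient [set: cantor_space] measurable
    (fun A => fine (product_measure A)).

End Cantor.

(* Main.v *)
Require Import Defs.
From HB Require Import structures.
From mathcomp Require Import all_boot all_order all_algebra finmap.
From mathcomp Require Import boolp classical_sets functions.
From mathcomp Require Import cardinality wochoice reals ereal measure sequences.
From mathcomp Require Import topology normedtype zify ring lra.

(* The isomorphism is built by a back-and-forth of length omega_1. A stage is a
   countable subalgebra of the product of the two algebras on which the two
   measures agree. To extend it on the Cantor side, given a set B, one has to
   find an M-finite A whose intersections with the stage have prescribed
   measures: finitely many conditions are met up to epsilon by subsets of the
   atoms of suitable size, and saturation does the rest. In the other
   direction, given A, the conditional probabilities of A on finer and finer
   finite partitions form an L^2-bounded martingale; B is the limit of the sets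
   on which a uniform variable, made of coordinates that no set of the stage
   depends on, is below this martingale. After omega_1 steps every M-finite set
   has a partner and every coordinate has been reached; the sets with a partner
   are then dense on the Cantor side, and the saturation argument, applied to a
   stage that contains a sequence converging to B, finds a partner of B.

   The Maharam type is at least omega_1 because a countable set of classes
   is fixed by flipping some coordinate k, hence so is everything that it
   completely generates, but not the k-th coordinate itself. It is at most
   omega_1 because M has only omega_1 elements. *)

Set Implicit Arguments.
Unset Strict Implicit.
Unset Printing Implicit Defensive.
Import Order.TTheory GRing.Theory Num.Theory.
Import numFieldTopology.Exports.
Local Open Scope classical_set_scope.
Local Open Scope card_scope.
Local Open Scope nat_scope.

(** * Coding finite sets and functions in arithmetic *)

(** Two features shape the argument. The measure on the model side is a standard part, hence not
    definable in M, and the coded sets offer only finite Boolean operations. So a condition on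
    measures enters a type as countably many inequalities between internal cardinalities and
    standard fractions, one formula for each, and limits of sets are taken on the Cantor side alone;
    this is why the two extension steps differ. Both need a countable stage: a type may have
    countably many parameters, and countably many measurable sets leave uncountably many coordinates
    untouched.

    Stages consist of pairs of sets, not of classes, so that Boolean identities hold exactly and
    null sets matter only in the final passage to the quotients. Facts about finite sets in M are
    proved by counting in the standard model and transferred as one sentence; formulas are built so
    that their satisfaction computes to the statement wanted. *)

Lemma beta_mod a b x y : beta (M := standard_model) a b x y <->
  y = a %% (1 + (1 + x) * b).
Proof.
rewrite /beta /=; split=> [[yd [q ->]]|->]; first by rewrite modnMDl modn_small.
split; first by rewrite ltn_mod.
by exists (a %/ (1 + (1 + x) * b)); apply: divn_eq.
Qed.

(** A common prime factor divides the difference (y - x) * b. Since y - x divides W!, which divides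
    b, it divides b in either case, and then it divides 1. *)
Lemma beta_moduli_coprime W b x y : W`! %| b -> x < y -> y < W ->
  coprime (1 + (1 + x) * b) (1 + (1 + y) * b).
Proof.
move=> Wb xy yW; rewrite coprime_sym.
apply/coprimeP; first by [].
case: (boolP (coprime (1 + (1 + y) * b) (1 + (1 + x) * b))) => [/coprimeP|].
  by apply.
rewrite /coprime => /negP[]; apply/eqP.
have := erefl (gcdn (1 + (1 + y) * b) (1 + (1 + x) * b)).
move: {2}(gcdn _ _) => g gE.
apply/eqP; case: (ltnP 1 g) => [g1|]; last first.
  have : 0 < g by rewrite -gE gcdn_gt0.
  by move: gE => <-; case: (gcdn _ _) => [|[|]].
have pg := pdiv_dvd g; have pp := pdiv_prime g1.
have py : pdiv g %| 1 + (1 + y) * b by rewrite (dvdn_trans pg) // -gE dvdn_gcdl.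
have px : pdiv g %| 1 + (1 + x) * b by rewrite (dvdn_trans pg) // -gE dvdn_gcdr.
suff pb : pdiv g %| b.
  by move: px; rewrite dvdn_addl ?dvdn_mull// dvdn1 => /eqP p1; rewrite p1 in pp.
have : pdiv g %| (1 + (1 + y) * b) - (1 + (1 + x) * b) by rewrite dvdn_sub.
have -> : (1 + (1 + y) * b) - (1 + (1 + x) * b) = (y - x) * b
  by rewrite subnDl -mulnBl subnDl.
rewrite Euclid_dvdM // => /orP[pyx|//].
apply: dvdn_trans Wb; apply: (dvdn_trans pyx).
by rewrite dvdn_fact// subn_gt0 xy (leq_trans (leq_subr x y) (ltnW yW)).
Qed.

(** Chinese remaindering, one modulus at a time; the bound on f makes each value its own
    remainder. *)
Lemma beta_code W b f : W`! %| b -> (forall x, x < W -> f x < 1 + (1 + x) * b) ->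
  exists a, forall x, x < W -> beta (M := standard_model) a b x (f x).
Proof.
move=> Wb fb; pose d x := 1 + (1 + x) * b.
suff [a aP] : exists a, forall x, x < W -> a = f x %[mod d x].
  exists a => x xW; apply/beta_mod; rewrite [RHS]aP// modn_small//; exact: fb.
have : W <= W by [].
elim: {1 3}W => [|n IH] nW; first by exists 0.
have [a aP] := IH (ltnW nW).
pose D := \prod_(i < n) d i.
have co : coprime D (d n).
  rewrite /D; elim/big_ind: _ => [|u v cu cv|i _]; first exact: coprime1n.
    by rewrite coprimeMl cu.
  exact: (@beta_moduli_coprime W).
exists (chinese D (d n) a (f n)) => x; rewrite ltnS leq_eqVlt => /orP[/eqP->|xn].
  by rewrite chinese_modr.
have dD : d x %| D by rewrite /D (bigD1 (Ordinal xn)) //= dvdn_mulr.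
rewrite -aP// -[LHS](modn_dvdm _ dD) chinese_modl// modn_dvdm//.
Qed.

(** First-order version of [has_internal_card]: the bijection is present only through its code (u,
    v), so the whole statement is a formula. *)
Definition card_in (S : arith_structure) (W b a n : S) : Prop :=
  exists u v : S,
    (forall x : S, alt x W -> beta a b x (azero S) ->
      exists y : S, alt y n /\ beta u v x y) /\
    (forall y : S, alt y n ->
      exists x : S, alt x W /\ (beta a b x (azero S) /\ beta u v x y)) /\
    (forall x x' y : S, alt x W -> alt x' W -> beta a b x (azero S) ->
      beta a b x' (azero S) -> beta u v x y -> beta u v x' y -> x = x').

Definition coded (b a : nat) : pred nat := fun x => a %% (1 + (1 + x) * b) == 0.

Lemma codedP b a x :
  reflect (beta (M := standard_model) a b x (0 : nat)) (coded b a x).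
Proof.
by apply: (iffP eqP) => [h|/beta_mod h //]; apply/beta_mod; rewrite h.
Qed.

Lemma card_in_count (W b a n : nat) :
  card_in (S := standard_model) W b a n <-> n = count (coded b a) (iota 0 W).
Proof.
rewrite -size_filter; set s := [seq x <- _ | _].
have sE x : (x \in s) = coded b a x && (x < W).
  by rewrite mem_filter mem_iota.
have s_uniq : uniq s by rewrite filter_uniq ?iota_uniq.
split=> [[u [v [Aim [Asurj Ainj]]]]|->].
  pose g x := u %% (1 + (1 + x) * v).
  have gP x : beta (M := standard_model) u v x (g x) by apply/beta_mod.
  rewrite -(size_map g) -[n in LHS](size_iota 0); apply/esym/perm_size/uniq_perm.
  - rewrite map_inj_in_uniq// => x x'; rewrite !sE => /andP[/codedP ax xW].
    by move=> /andP[/codedP ax' xW'] gE; apply: (Ainj x x' (g x)) => //; rewrite gE.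
  - exact: iota_uniq.
  move=> y; rewrite mem_iota /= add0n; apply/mapP/idP => [[x]|yn].
    rewrite sE => /andP[/codedP ax xW] ->.
    by have [z [zn /beta_mod zE]] := Aim x xW ax; rewrite /g -zE.
  have [x [xW [/codedP ax /beta_mod ->]]] := Asurj y yn.
  by exists x => //; rewrite sE ax.
(* Divisible by W!, which makes the moduli coprime, and at least [size s], so that every index is
   below its modulus. *)
pose c := (W + size s)`!.
have [|x xW|u uP] := @beta_code W c (fun x => index x s).
- by rewrite /c -(bin_fact (leq_addr (size s) W)) dvdn_mull// dvdn_mulr.
- rewrite add1n ltnS; apply: leq_trans (index_size x s) _.
  apply: (leq_trans (leq_addl W _)); apply: (leq_trans (fact_geq _)).
  by rewrite mulSn leq_addr.
exists u, c; split=> [x xW /codedP ax|].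
  exists (index x s); split; last exact: uP.
  by rewrite /= index_mem sE ax.
split=> [y /= ys|x x' y /= xW xW' /codedP ax /codedP ax'].
  have : nth 0 s y \in s by rewrite mem_nth.
  rewrite sE => /andP[ax xW]; exists (nth 0 s y); split=> //; split.
    exact/codedP.
  by have := uP _ xW; rewrite index_uniq.
have /beta_mod xE := uP _ xW; have /beta_mod xE' := uP _ xW'.
move=> /beta_mod ->; rewrite -xE => /beta_mod; rewrite -xE'.
move=> /(congr1 (nth 0 s)); rewrite !nth_index // sE ?ax ?ax'//.
Qed.

(* Terms and formulas as functions of the number of enclosing quantifiers, so
   that a bound variable can be named by a metavariable; [sat] of a closed
   such formula then computes to the statement it expresses. [pfree k] is the
   free variable [k]. *)
Definition pterm := nat -> aterm.
Definition pformula := nat -> aformula.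
Definition pbound (l : nat) : pterm := fun d => TVar (d - l.+1).
Definition pfree (k : nat) : pterm := fun d => TVar (d + k).
Definition p0 : pterm := fun=> TZero.
Definition p1 : pterm := fun=> TOne.
Definition padd (s t : pterm) : pterm := fun d => TAdd (s d) (t d).
Definition pmul (s t : pterm) : pterm := fun d => TMul (s d) (t d).
Definition peq (s t : pterm) : pformula := fun d => FEq (s d) (t d).
Definition plt (s t : pterm) : pformula := fun d => FLt (s d) (t d).
Definition pfalse : pformula := fun=> FFalse.
Definition pimp (p q : pformula) : pformula := fun d => FImp (p d) (q d).
Definition pand (p q : pformula) : pformula := fun d => FAnd (p d) (q d).
Definition por (p q : pformula) : pformula := fun d => FOr (p d) (q d).
Definition pall (F : pterm -> pformula) : pformula :=
  fun d => FAll (F (pbound d) d.+1).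
Definition pex (F : pterm -> pformula) : pformula :=
  fun d => FEx (F (pbound d) d.+1).
Definition pnot p := pimp p pfalse.
Definition ple s t := por (plt s t) (peq s t).

Fixpoint pnum (n : nat) : pterm := if n is k.+1 then padd (pnum k) p1 else p0.

Definition pbeta (a b x y : pterm) : pformula :=
  let d := padd p1 (pmul (padd p1 x) b) in
  pand (plt y d) (pex (fun q => peq a (padd (pmul q d) y))).

Definition pcard (W b a n : pterm) : pformula :=
  pex (fun u => pex (fun v =>
   pand (pall (fun x => pimp (plt x W) (pimp (pbeta a b x p0)
      (pex (fun y => pand (plt y n) (pbeta u v x y))))))
  (pand (pall (fun y => pimp (plt y n)
      (pex (fun x => pand (plt x W) (pand (pbeta a b x p0) (pbeta u v x y))))))
   (pall (fun x => pall (fun x' => pall (fun y => pimp (plt x W) (pimp (plt x' W)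
      (pimp (pbeta a b x p0) (pimp (pbeta a b x' p0)
      (pimp (pbeta u v x y) (pimp (pbeta u v x' y) (peq x x'))))))))))))).

Lemma teval_pnum (M : arith_structure) e n d : teval e (pnum n d) = numeral M n.
Proof. by elim: n => //= n ->. Qed.

Lemma numeral_standard n : numeral standard_model n = n.
Proof. by elim: n => //= n ->; rewrite addn1. Qed.

Lemma pnum_closed n d : term_vars_below 0 (pnum n d).
Proof. by elim: n => //= n ->. Qed.

(** Everything about finite sets that is needed in M, as one sentence with one modulus b for all
    subsets of W: recoding, difference, the full set, existence, uniqueness and additivity of
    cardinality, and subsets of every smaller cardinality. Equivalences are split into two
    implications because the language has no connective for them. *)
Definition coded_sets_property (S : arith_structure) : Prop :=
  let mem (b a x : S) := beta a b x (azero S) in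
  forall W : S, exists b : S,
  (forall a' b', exists a, forall x, alt x W ->
     (mem b a x -> mem b' a' x) /\ (mem b' a' x -> mem b a x)) /\
  (forall a a', exists a'', forall x, alt x W ->
     (mem b a'' x -> mem b a x /\ ~ mem b a' x) /\
     (mem b a x /\ ~ mem b a' x -> mem b a'' x)) /\
  (exists a, (forall x, alt x W -> mem b a x) /\ card_in W b a W) /\
  (forall a, exists n, card_in W b a n) /\
  (forall a n n', card_in W b a n -> card_in W b a n' -> n = n') /\
  (forall a a' a'' n n' n'',
    (forall x, alt x W -> (mem b a'' x -> mem b a x \/ mem b a' x) /\
       (mem b a x \/ mem b a' x -> mem b a'' x)) ->
    (forall x, alt x W -> mem b a x -> mem b a' x -> False) ->
    card_in W b a n -> card_in W b a' n' -> card_in W b a'' n'' ->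
    n'' = aadd n n') /\
  (forall a n m, card_in W b a n -> alt m n ->
    exists a', (forall x, alt x W -> mem b a' x -> mem b a x) /\
      card_in W b a' m).

Definition coded_sets_formula : pformula :=
  let mem (b a x : pterm) := pbeta a b x p0 in
  pall (fun W => pex (fun b =>
  pand (pall (fun a' => pall (fun b' => pex (fun a => pall (fun x => pimp (plt x W)
     (pand (pimp (mem b a x) (mem b' a' x)) (pimp (mem b' a' x) (mem b a x))))))))
  (pand (pall (fun a => pall (fun a' => pex (fun a'' => pall (fun x => pimp (plt x W)
     (pand (pimp (mem b a'' x) (pand (mem b a x) (pnot (mem b a' x))))
     (pimp (pand (mem b a x) (pnot (mem b a' x))) (mem b a'' x))))))))
  (pand (pex (fun a => pand (pall (fun x => pimp (plt x W) (mem b a x))) (pcard W b a W)))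
  (pand (pall (fun a => pex (fun n => pcard W b a n)))
  (pand (pall (fun a => pall (fun n => pall (fun n' =>
     pimp (pcard W b a n) (pimp (pcard W b a n') (peq n n'))))))
  (pand (pall (fun a => pall (fun a' => pall (fun a'' =>
         pall (fun n => pall (fun n' => pall (fun n'' =>
    pimp (pall (fun x => pimp (plt x W)
       (pand (pimp (mem b a'' x) (por (mem b a x) (mem b a' x)))
             (pimp (por (mem b a x) (mem b a' x)) (mem b a'' x)))))
    (pimp (pall (fun x => pimp (plt x W) (pimp (mem b a x) (pimp (mem b a' x) pfalse))))
    (pimp (pcard W b a n) (pimp (pcard W b a' n') (pimp (pcard W b a'' n'')
      (peq n'' (padd n n')))))))))))))
  (pall (fun a => pall (fun n => pall (fun m =>
    pimp (pcard W b a n) (pimp (plt m n)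
    (pex (fun a' => pand (pall (fun x => pimp (plt x W)
         (pimp (mem b a' x) (mem b a x))))
      (pcard W b a' m))))))))))))))).

Lemma sat_coded_sets (S : arith_structure) (e : nat -> S) :
  sat e (coded_sets_formula 0) = coded_sets_property S.
Proof. by []. Qed.

Lemma coded_exists W b P : W`! %| b -> 0 < b ->
  exists a, forall x, x < W -> coded b a x = P x.
Proof.
(* Remainder 0 stands for membership and remainder 1 for non-membership; [0 < b] makes every modulus
   exceed 1. *)
move=> Wb b0; have [|a aP] := @beta_code W b (fun x => ~~ P x) Wb.
  by move=> x _; case: (P x) => //=; rewrite add1n ltnS mulSn addn_gt0 b0.
exists a => x xW; have /beta_mod aE := aP x xW.
by rewrite /coded -aE; case: (P x).
Qed.

Lemma coded_sets_standard : coded_sets_property standard_model.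
Proof.
move=> W; exists W`!.
have ex P := @coded_exists W _ P (dvdnn _) (fact_gt0 W).
have memE a b x : beta (M := standard_model) a b x (azero standard_model) <->
  coded b a x by split=> /codedP.
have countE (P Q : pred nat) : (forall x, x < W -> P x = Q x) ->
    count P (iota 0 W) = count Q (iota 0 W).
  by move=> PQ; apply: eq_in_count => x; rewrite mem_iota => /PQ.
do ![split].
- move=> a' b'; have [a aP] := ex (coded b' a').
  by exists a => x xW; rewrite !memE aP.
- move=> a a'; have [a'' aP] := ex (fun x => coded W`! a x && ~~ coded W`! a' x).
  exists a'' => x xW; rewrite !memE aP//.
  by split=> [/andP[-> /negP]|[-> /negP]].
- have [a aP] := ex predT; exists a; split=> [x xW|]; first by rewrite memE aP.
  by apply/card_in_count; rewrite (countE _ _ aP) count_predT size_iota.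
- by move=> a; eexists; apply/card_in_count.
- by move=> a n n' /card_in_count -> /card_in_count ->.
- move=> a a' a'' n n' n'' U D /card_in_count -> /card_in_count -> /card_in_count ->.
  rewrite -[RHS]/(count (coded W`! a) (iota 0 W) +
    count (coded W`! a') (iota 0 W)) -count_predUI.
  rewrite [X in _ + X](@countE _ pred0) => [|x xW /=]; last first.
    by apply/negP => /andP[/memE ax /memE]; apply: D ax.
  rewrite count_pred0 addn0; apply: countE => x xW /=.
  have [U1 U2] := U x xW.
  apply/idP/orP => [/memE/U1[]/memE ->|[]/memE ax]; [by left|by right|..].
    by apply/memE/U2; left.
  by apply/memE/U2; right.
move=> a n m /card_in_count nE mn.
pose s := [seq x <- iota 0 W | coded W`! a x].
have [a' aP] := ex [in take m s]; exists a'; split=> [x xW /memE|].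
  by rewrite aP// => /mem_take; rewrite mem_filter memE => /andP[].
apply/card_in_count; rewrite (countE _ _ aP) -size_filter.
have ms : m < size s by rewrite size_filter -nE.
rewrite -[m in LHS](size_takel (ltnW ms)); apply/perm_size/uniq_perm.
- by rewrite take_uniq// filter_uniq// iota_uniq.
- by rewrite filter_uniq// iota_uniq.
move=> x; rewrite mem_filter; apply/idP/andP => [xs|[]//]; split=> //.
by move/mem_take: xs; rewrite mem_filter => /andP[].
Qed.

Lemma transfer (M : arith_structure) (p : pformula) :
  model_of_true_arithmetic M -> sentence (p 0) ->
  (forall e, sat (M := standard_model) e (p 0)) ->
  forall e : nat -> M, sat e (p 0).
Proof. by move=> MTA ps pN; apply: MTA; split. Qed.

Lemma coded_sets_model (M : arith_structure) :
  model_of_true_arithmetic M -> coded_sets_property M.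
Proof.
move=> MTA; rewrite -(sat_coded_sets (fun=> azero M)).
apply: transfer => // e; exact: coded_sets_standard.
Qed.

Local Open Scope ring_scope.

(** * Standard parts *)

(** Fractions are compared by cross-multiplication: m q <= n p stands for m / n <= p / q. In the
    last three clauses c is the integer part of p q / N, and c / q has the same rational lower
    bounds as p / N, up to a rounding error that a large q absorbs. *)
Definition arith_property (S : arith_structure) : Prop :=
  let le (x y : S) := ale x y in
  let lt (x y : S) := alt x y in
  let add (x y : S) := aadd x y in
  let mul (x y : S) := amul x y in
  let zero := azero S in
  (forall x y, lt x y \/ le y x) /\
  (forall x y, lt x y -> le y x -> False) /\
  (forall x y z, le x y -> le y z -> le x z) /\
  (forall x y, le x (add x y) /\ le y (add x y)) /\
  (forall x y, lt x y -> le (add x (aone S)) y) /\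
  (forall x, le zero x) /\
  (forall n p q, le (mul zero q) (mul n p)) /\
  (forall m n m' n' p p' q, le (mul m q) (mul n p) ->
    le (mul m' q) (mul n' p') ->
    le (mul (add (mul m n') (mul m' n)) q) (mul (mul n n') (add p p'))) /\
  (forall m n m' n' p p' q, lt zero n -> lt zero n' ->
    lt (mul n p) (mul m q) -> lt (mul n' p') (mul m' q) ->
    lt (mul (mul n n') (add p p')) (mul (add (mul m n') (mul m' n)) q)) /\
  (forall m n p p' q, le p p' -> le (mul m q) (mul n p) ->
    le (mul m q) (mul n p')) /\
  (forall m n p q, lt zero q -> le p q -> le (mul m q) (mul n p) -> le m n) /\
  (forall m n m' n' p q, lt (mul n p) (mul m q) -> le (mul m' q) (mul n' p) ->
    le (mul m' n) (mul m n')) /\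
  (forall N p q, lt zero N -> le p N -> exists c, le c q /\
    (le (mul N c) (mul p q) /\
    lt (mul p q) (mul N (add c (aone S))))) /\
  (forall N m p n c q, le (add (mul N m) (aone S)) (mul p n) ->
    lt (mul p q) (mul N (add c (aone S))) -> le (mul n N) q ->
    le (mul m q) (mul n c)) /\
  (forall N m p n c q, lt zero q -> le (mul N c) (mul p q) ->
    le (mul m q) (mul n c) -> le (mul N m) (mul n p)).

Definition arith_formula : pformula :=
  let le := ple in let lt := plt in let add := padd in let mul := pmul in
  let zero := p0 in
  pand (pall (fun x => pall (fun y => por (lt x y) (le y x))))
  (pand (pall (fun x => pall (fun y => pimp (lt x y) (pimp (le y x) pfalse))))
  (pand (pall (fun x => pall (fun y => pall (fun z =>
     pimp (le x y) (pimp (le y z) (le x z))))))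
  (pand (pall (fun x => pall (fun y => pand (le x (add x y)) (le y (add x y)))))
  (pand (pall (fun x => pall (fun y => pimp (lt x y) (le (add x p1) y))))
  (pand (pall (fun x => le zero x))
  (pand (pall (fun n => pall (fun p => pall (fun q => le (mul zero q) (mul n p)))))
  (pand (pall (fun m => pall (fun n => pall (fun m' => pall (fun n' =>
     pall (fun p => pall (fun p' => pall (fun q =>
       pimp (le (mul m q) (mul n p)) (pimp (le (mul m' q) (mul n' p'))
       (le (mul (add (mul m n') (mul m' n)) q) (mul (mul n n') (add p p')))))))))))
  ) (pand (pall (fun m => pall (fun n => pall (fun m' => pall (fun n' =>
     pall (fun p => pall (fun p' => pall (fun q =>
       pimp (lt zero n) (pimp (lt zero n')
       (pimp (lt (mul n p) (mul m q)) (pimp (lt (mul n' p') (mul m' q))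
       (lt (mul (mul n n') (add p p')) (mul (add (mul m n') (mul m' n)) q)))))))))))
  )) (pand (pall (fun m => pall (fun n => pall (fun p => pall (fun p' => pall (fun q =>
     pimp (le p p') (pimp (le (mul m q) (mul n p)) (le (mul m q) (mul n p')))))))))
  (pand (pall (fun m => pall (fun n => pall (fun p => pall (fun q =>
     pimp (lt zero q) (pimp (le p q) (pimp (le (mul m q) (mul n p)) (le m n))))))))
  (pand (pall (fun m => pall (fun n => pall (fun m' => pall (fun n' =>
     pall (fun p => pall (fun q =>
       pimp (lt (mul n p) (mul m q)) (pimp (le (mul m' q) (mul n' p))
       (le (mul m' n) (mul m n'))))))))))
  (pand (pall (fun N => pall (fun p => pall (fun q => pimp (lt zero N)
     (pimp (le p N) (pex (fun c => pand (le c q) (pand (le (mul N c) (mul p q))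
       (lt (mul p q) (mul N (add c p1)))))))))))
  (pand (pall (fun N => pall (fun m => pall (fun p => pall (fun n =>
     pall (fun c => pall (fun q => pimp (le (add (mul N m) p1) (mul p n))
       (pimp (lt (mul p q) (mul N (add c p1)))
       (pimp (le (mul n N) q) (le (mul m q) (mul n c))))))))))
  ) (pall (fun N => pall (fun m => pall (fun p => pall (fun n =>
     pall (fun c => pall (fun q => pimp (lt zero q)
       (pimp (le (mul N c) (mul p q))
       (pimp (le (mul m q) (mul n c)) (le (mul N m) (mul n p)))))))))))))))))))))))).

Lemma sat_arith (S : arith_structure) (e : nat -> S) :
  sat e (arith_formula 0) = arith_property S.
Proof. by []. Qed.

Lemma aleN (x y : nat) : @ale standard_model x y <-> (x <= y)%N.
Proof.
rewrite leq_eqVlt; split=> [[/= ->|->]|/orP[/eqP ->|]]; rewrite ?eqxx ?orbT//.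
- by right.
- by left.
Qed.

Lemma arith_standard : arith_property standard_model.
Proof.
have E := aleN; rewrite /arith_property /=.
do ![split].
- by move=> x y; rewrite E; case: ltnP; [left|right].
- by move=> x y; rewrite E => ? ?; lia.
- by move=> x y z; rewrite !E => ? ?; lia.
- by apply/E; lia.
- by apply/E; lia.
- by move=> x y; rewrite E => ?; lia.
- by move=> x; rewrite E.
- by move=> n p q; rewrite E mul0n.
- move=> m n m' n' p p' q; rewrite !E => h h'.
  have := leq_mul h (leqnn n'); have := leq_mul h' (leqnn n); lia.
- move=> m n m' n' p p' q n0 n'0 h h'.
  have : (n * p * n' < m * q * n')%N by rewrite ltn_pmul2r.
  have : (n' * p' * n < m' * q * n)%N by rewrite ltn_pmul2r.
  lia.
- move=> m n p p' q; rewrite !E => h h'.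
  have := leq_mul (leqnn n) h; lia.
- move=> m n p q q0; rewrite !E => h h'.
  have {}h := leq_mul (leqnn n) h.
  by have := leq_trans h' h; rewrite leq_pmul2r.
- move=> m n m' n' p q h; rewrite !E => h'.
  have q0 : (0 < q)%N by nia.
  rewrite -(leq_pmul2r q0).
  have := leq_mul h' (leqnn n); have := leq_mul (ltnW h) (leqnn n').
  lia.
- move=> N p q N0; rewrite E => pN; exists (p * q %/ N)%N; rewrite !E.
  split; first by rewrite -[leqRHS](mulKn q N0); apply/leq_div2r/leq_mul.
  split; first by rewrite mulnC leq_trunc_div.
  by have := ltn_ceil (p * q) N0; rewrite /= addn1 [(N * _)%N]mulnC.
- move=> N m p n c q; rewrite !E => h1 h2 h3.
  have N0 : (0 < N)%N by case: (N) h2.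
  rewrite -(leq_pmul2l N0).
  have := leq_mul h1 (leqnn q).
  have := leq_mul (leqnn n) (ltnW h2).
  lia.
move=> N m p n c q q0; rewrite !E => h1 h2.
rewrite -(leq_pmul2r q0).
have := leq_mul (leqnn N) h2; have := leq_mul (leqnn n) h1.
lia.
Qed.

Lemma arith_model (M : arith_structure) :
  model_of_true_arithmetic M -> arith_property M.
Proof.
move=> MTA; rewrite -(sat_arith (fun=> azero M)).
apply: transfer => // e; exact: arith_standard.
Qed.

Lemma rational_between (R : archiRealFieldType) (x y : R) : 0 <= x -> x < y ->
  exists m n : nat, (0 < n)%N /\ x < m%:R / n%:R < y.
Proof.
move=> x0 xy; have d0 : 0 < y - x by rewrite subr_gt0.
have dV : 0 < (y - x)^-1 by rewrite invr_gt0.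
pose n := (Num.truncn (y - x)^-1).+1.
have n0 : (0 : R) < n%:R by rewrite ltr0n.
have nd : 1 < (y - x) * n%:R.
  rewrite -(@ltr_pM2l _ (y - x)^-1)// mulr1 mulrA mulVf ?mul1r ?gt_eqF//.
  by have /andP[_] := truncn_itv (ltW dV).
have xn0 : 0 <= x * n%:R by rewrite mulr_ge0// ltW.
have /andP[l r] := truncn_itv xn0.
exists (Num.truncn (x * n%:R)).+1, n; split=> //.
rewrite ltr_pdivlMr// r /= ltr_pdivrMr// -natr1.
apply: (@le_lt_trans _ _ (x * n%:R + 1)); first by rewrite lerD2r.
by rewrite -ltrBrDl -mulrBl.
Qed.

Section StandardPart.
Variables (R : realType) (M : arith_structure) (W : M).
Hypothesis MTA : model_of_true_arithmetic M.
Hypothesis Wns : nonstandard W.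

Local Notation "x '+m' y" := (aadd x y) (at level 50, left associativity).
Local Notation "x '*m' y" := (amul x y) (at level 40, left associativity).
Local Notation num := (numeral M).
Local Notation st p := (st_ratio R p W).

(** Being standard is not a first-order property, but each instance is a closed sentence about two
    numerals and is transferred by itself. *)
Lemma numeralD m n : num m +m num n = num (m + n)%N.
Proof.
rewrite -(teval_pnum (fun=> azero M) m 0) -(teval_pnum (fun=> azero M) n 0).
rewrite -(teval_pnum (fun=> azero M) (m + n) 0).
have := @transfer M (peq (padd (pnum m) (pnum n)) (pnum (m + n)%N)) MTA.
apply; first by rewrite /sentence /= !pnum_closed.
by move=> e; rewrite /= !teval_pnum !numeral_standard.
Qed.

Lemma numeralM m n : num m *m num n = num (m * n)%N.
Proof.
rewrite -(teval_pnum (fun=> azero M) m 0) -(teval_pnum (fun=> azero M) n 0).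
rewrite -(teval_pnum (fun=> azero M) (m * n) 0).
have := @transfer M (peq (pmul (pnum m) (pnum n)) (pnum (m * n)%N)) MTA.
apply; first by rewrite /sentence /= !pnum_closed.
by move=> e; rewrite /= !teval_pnum !numeral_standard.
Qed.

Lemma numeral_le m n : (m <= n)%N -> ale (num m) (num n).
Proof.
move=> mn; rewrite -(teval_pnum (fun=> azero M) m 0).
rewrite -(teval_pnum (fun=> azero M) n 0).
have := @transfer M (ple (pnum m) (pnum n)) MTA.
apply; first by rewrite /sentence /= !pnum_closed.
by move=> e; rewrite /= !teval_pnum !numeral_standard; apply/aleN.
Qed.

Lemma numeral_lt m n : (m < n)%N -> alt (num m) (num n).
Proof.
move=> mn; rewrite -(teval_pnum (fun=> azero M) m 0).
rewrite -(teval_pnum (fun=> azero M) n 0).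
have := @transfer M (plt (pnum m) (pnum n)) MTA.
apply; first by rewrite /sentence /= !pnum_closed.
by move=> e; rewrite /= !teval_pnum !numeral_standard.
Qed.

Lemma le_numeral m n : ale (num m) (num n) -> (m <= n)%N.
Proof.
have [_ [ltle _]] := arith_model MTA.
by case: leqP => // /numeral_lt nm /(ltle _ _ nm).
Qed.

Lemma alt_le (x y : M) : alt x y -> ale x y. Proof. by left. Qed.

Lemma numeral_lt_nonstandard n : alt (num n) W.
Proof.
have [_ [_ [_ [_ [S [z _]]]]]] := arith_model MTA.
elim: n => [|n /S [//|eW]].
  by case: (z W) => [//|eW]; have := Wns (n := 0%N); rewrite -eW.
by have := Wns (n := n.+1); rewrite -eW.
Qed.

Let W0 : alt (azero M) W. Proof. exact: (numeral_lt_nonstandard 0). Qed.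

Let L (p : M) : set R := [set r : R | exists m n : nat, [/\ (0 < n)%N,
    ale (num m *m W) (num n *m p) & r = (m%:R / n%:R)%R]].

Lemma st_le (p : M) (r : R) :
  (forall m n, (0 < n)%N -> ale (num m *m W) (num n *m p) -> m%:R / n%:R <= r) ->
  st p <= r.
Proof.
move=> Lr; apply: (@ge_sup _ (L p)) => [|_ [m [n [n0 mn ->]]]]; last exact: Lr.
exists 0, 0%N, 1%N; split=> //; last by rewrite mul0r.
by have [_ [_ [_ [_ [_ [_ [h _]]]]]]] := arith_model MTA; apply: h.
Qed.

Lemma le_st p m n : ale p W -> (0 < n)%N ->
  ale (num m *m W) (num n *m p) -> (m%:R / n%:R : R) <= st p.
Proof.
move=> pW n0 mn; apply: (@ub_le_sup _ (L p)); last by exists m, n.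
exists 1 => _ [m' [n' [n'0 mn' ->]]].
have [_ [_ [_ [_ [_ [_ [_ [_ [_ [_ [h _]]]]]]]]]]] := arith_model MTA.
have := h _ _ _ _ W0 pW mn'.
by move/le_numeral; rewrite ler_pdivrMr ?ltr0n// mul1r ler_nat.
Qed.

Lemma st_ge0 p : ale p W -> 0 <= st p.
Proof.
move=> pW; have -> : (0 : R) = 0%:R / 1%:R by rewrite mul0r.
apply: le_st => //.
by have [_ [_ [_ [_ [_ [_ [h _]]]]]]] := arith_model MTA; apply: h.
Qed.

Lemma lt_st p m n : (0 < n)%N -> (m%:R / n%:R : R) < st p ->
  ale (num m *m W) (num n *m p).
Proof.
move=> n0 mnp.
have [lt_total [_ [_ [_ [_ [_ [_ [_ [_ [_ [_ [h _]]]]]]]]]]]] := arith_model MTA.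
case: (lt_total (num n *m p) (num m *m W)) => // npm; exfalso.
move: mnp; rewrite ltNge => /negP; apply; apply: st_le => m' n' n'0 mn'.
have := h _ _ _ _ _ _ npm mn'; rewrite !numeralM => /le_numeral.
by rewrite ler_pdivrMr ?ltr0n// mulrAC ler_pdivlMr ?ltr0n// -!natrM ler_nat.
Qed.

Lemma st_lt p m n : ale p W -> (0 < n)%N -> st p < (m%:R / n%:R : R) ->
  alt (num n *m p) (num m *m W).
Proof.
move=> pW n0; have [lt_total _] := arith_model MTA.
case: (lt_total (num n *m p) (num m *m W)) => // /(le_st pW n0).
by rewrite leNgt => /negbTE ->.
Qed.

Lemma ale_refl (x : M) : ale x x. Proof. by right. Qed.

Lemma st_mono p p' : ale p p' -> ale p' W -> st p <= st p'.
Proof.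
move=> pp' p'W; apply: st_le => m n n0 mn; apply: le_st => //.
have [_ [_ [_ [_ [_ [_ [_ [_ [_ [h _]]]]]]]]]] := arith_model MTA.
exact: h mn.
Qed.

Lemma st1 : st W = 1.
Proof.
have E : (1 : R) = 1%:R / 1%:R by rewrite divr1.
apply/eqP; rewrite eq_le; apply/andP; split; last first.
  by rewrite [leLHS]E; apply: le_st => //; apply: ale_refl.
apply: st_le => m n n0 mn.
have [_ [_ [_ [_ [_ [_ [_ [_ [_ [_ [h _]]]]]]]]]]] := arith_model MTA.
have := h _ _ _ _ W0 (ale_refl _) mn.
by move/le_numeral; rewrite ler_pdivrMr ?ltr0n// mul1r ler_nat.
Qed.

Lemma stD p p' : ale (p +m p') W -> st (p +m p') = st p + st p'.
Proof.
move=> ppW; have [_ [_ [le_trans [leD [_ [_ [_ [addle [addlt _]]]]]]]]] :=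
  arith_model MTA.
have pW : ale p W by apply: le_trans ppW; have [] := leD p p'.
have p'W : ale p' W by apply: le_trans ppW; have [] := leD p p'.
have nE m n m' n' : (0 < n)%N -> (0 < n')%N ->
    ((m * n' + m' * n)%:R / (n * n')%:R : R) = m%:R / n%:R + m'%:R / n'%:R.
  move=> n0 n'0; rewrite natrD !natrM; field.
  by rewrite !pnatr_eq0 -!lt0n n0 n'0.
apply/eqP; rewrite eq_le; apply/andP; split.
  rewrite leNgt; apply/negP => lt_st.
  (* Half of the supposed excess: fractions above [st p] and [st p'] by less than d add up to an
     upper bound of [st (p +m p')] that is smaller than it. *)
  pose d := (st (p +m p') - (st p + st p')) / 2.
  have d0 : 0 < d by rewrite divr_gt0// subr_gt0.
  have [|m [n [n0 /andP[pm md]]]] :=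
    @rational_between R (st p) (st p + d) (st_ge0 pW); first by rewrite ltrDl.
  have [|m' [n' [n'0 /andP[pm' md']]]] :=
    @rational_between R (st p') (st p' + d) (st_ge0 p'W); first by rewrite ltrDl.
  have := addlt _ _ _ _ _ _ _ (numeral_lt n0) (numeral_lt n'0)
    (st_lt pW n0 pm) (st_lt p'W n'0 pm').
  rewrite !numeralM numeralD => /alt_le h.
  have : st (p +m p') <= m%:R / n%:R + m'%:R / n'%:R.
    rewrite -nE//; apply: st_le => k l l0 kl.
    have [_ [ltle [_ [_ [_ [_ [_ [_ [_ [_ [_ [cmp _]]]]]]]]]]]] := arith_model MTA.
    have nn0 : (0 < n * n')%N by rewrite muln_gt0 n0 n'0.
    have hlt := addlt _ _ _ _ _ _ _ (numeral_lt n0) (numeral_lt n'0)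
      (st_lt pW n0 pm) (st_lt p'W n'0 pm').
    rewrite !numeralM numeralD in hlt.
    have := cmp _ _ _ _ _ _ hlt kl; rewrite !numeralM => /le_numeral.
    by rewrite ler_pdivrMr ?ltr0n// mulrAC ler_pdivlMr ?ltr0n// -!natrM ler_nat.
  have dE : d + d = st (p +m p') - (st p + st p') by rewrite /d; lra.
  lra.
rewrite -lerBrDr; apply: st_le => m n n0 mn.
rewrite lerBrDl -lerBrDr; apply: st_le => m' n' n'0 mn'.
rewrite lerBrDl -nE//; apply: le_st => //; first by rewrite muln_gt0 n0 n'0.
by have := addle _ _ _ _ _ _ _ mn mn'; rewrite !numeralM numeralD.
Qed.

(** The witness is the integer part of m W / n. Rounding changes c / W by at most 1 / W, which is
    smaller than every positive standard fraction because W is nonstandard. *)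
Lemma st_division m n : (m <= n)%N -> (0 < n)%N ->
  exists c, ale c W /\ st c = m%:R / n%:R.
Proof.
move=> mn n0.
have [_ [_ [_ [_ [_ [_ [_ [_ [_ [_ [_ [_ [dv [dv1 dv2]]]]]]]]]]]]]] :=
  arith_model MTA.
have [c [cW [c1 c2]]] := dv (num n) (num m) W (numeral_lt n0) (numeral_le mn).
exists c; split=> //; apply/eqP; rewrite eq_le; apply/andP; split.
  apply: st_le => k l l0 /(dv2 _ _ _ _ _ _ W0 c1); rewrite !numeralM.
  move/le_numeral.
  rewrite ler_pdivrMr ?ltr0n// mulrAC ler_pdivlMr ?ltr0n// -!natrM ler_nat.
  by rewrite mulnC [(l * m)%N]mulnC.
rewrite leNgt; apply/negP => /(rational_between (st_ge0 cW)).
move=> [k [l [l0 /andP[ck kn]]]].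
move: ck; rewrite ltNge => /negP; apply; apply: le_st => //.
apply: (dv1 (num n) _ (num m)) => //.
  rewrite !numeralM; apply: (numeral_le (m := (n * k).+1)).
  move: kn; rewrite ltr_pdivrMr ?ltr0n// mulrAC ltr_pdivlMr ?ltr0n//.
  by rewrite -!natrM ltr_nat mulnC.
by rewrite numeralM; apply/alt_le/numeral_lt_nonstandard.
Qed.

End StandardPart.

(** * The algebra of coded sets and its saturation *)

Lemma finite_uniform (T : Type) (D : set T) (P : nat -> T -> Prop) :
  finite_set D -> (forall p, D p -> exists K, forall K', (K <= K')%N -> P K' p) ->
  exists K, forall p, D p -> P K p.
Proof.
elim/Ppointed: T => T in D P * => [_ _|[n]].
  by exists 0%N => p; rewrite emptyE_subdef.
rewrite card_eq_sym => /card_set_bijP[f [_ _ surj_f]] DP.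
have /choice[K KP] : forall i, exists K, D (f i) ->
    forall K', (K <= K')%N -> P K' (f i).
  move=> i; have [Di|nDi] := pselect (D (f i)); last by exists 0%N.
  by have [K KP] := DP _ Di; exists K.
exists (\max_(i < n) K i)%N => p Dp; have [i /= ni fi] := surj_f p Dp.
rewrite -fi; apply: KP; first by rewrite fi.
exact: (leq_bigmax (Ordinal ni)).
Qed.

Section CodedSets.
Variables (R : realType) (M : arith_structure) (W : M).
Hypothesis MTA : model_of_true_arithmetic M.
Hypothesis Wns : nonstandard W.

Local Notation F := (coded_subsets W).
Local Notation mu := (internal_measure R W).
Local Notation st p := (st_ratio R p W).

(* One modulus codes all M-finite subsets of [W], each by a single element. *)
Definition set_modulus : M := projT1 (cid (coded_sets_model MTA W)).
Local Notation b := set_modulus.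
Let bP := projT2 (cid (coded_sets_model MTA W)).
Definition coded_set (a : M) : set M :=
  [set x | below W x /\ beta a b x (azero M)].

Lemma coded_subsetsP A : F A <-> exists a, A = coded_set a.
Proof.
split=> [[a' [b' ->]]|[a ->]]; last by exists a, b.
have [+ _] := bP => /(_ a' b')[a aP]; exists a.
by apply/seteqP; split=> x [xW xa]; split=> //; apply/(aP x xW).
Qed.

Lemma coded_subset A : F A -> A `<=` below W.
Proof. by move=> [a [b' ->]] x []. Qed.

Lemma codedD A B : F A -> F B -> F (A `\` B).
Proof.
move=> /coded_subsetsP[a ->] /coded_subsetsP[a' ->]; apply/coded_subsetsP.
have [_ [+ _]] := bP => /(_ a a')[a'' aP]; exists a''.
apply/seteqP; split=> x /=.
  move=> [[xW xa] nxa']; split=> //; apply/(aP x xW); split=> // xa'.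
  exact: nxa'.
by move=> [xW /(aP x xW)[xa nxa']]; split=> // -[_ /nxa'].
Qed.

Lemma codedT : F (below W).
Proof.
apply/coded_subsetsP; have [_ [_ [[a [aP _]] _]]] := bP; exists a.
by apply/seteqP; split=> x //= => [xW|[]//]; split=> //; apply: aP.
Qed.

Lemma codedI A B : F A -> F B -> F (A `&` B).
Proof. by move=> FA FB; rewrite -setDD; do 2?apply: codedD. Qed.

Lemma codedU A B : F A -> F B -> F (A `|` B).
Proof.
move=> FA FB.
have -> : A `|` B = below W `\` ((below W `\` A) `\` B).
  apply/seteqP; split=> x /=.
    move=> AB; split; first by case: AB; apply: coded_subset.
    by move=> [[_ nA] nB]; case: AB.
  move=> [xW nAB]; apply: contrapT => /not_orP[nA nB].
  by apply: nAB.
by do !apply: codedD => //; apply: codedT.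
Qed.

Lemma beta_unique (a c x y y' : M) : beta a c x y -> beta a c x y' -> y = y'.
Proof.
move=> h h'; move: (a) (c) (x) (y) (y') h h'.
have := @transfer M (pall (fun a => pall (fun c => pall (fun x => pall (fun y =>
  pall (fun y' => pimp (pbeta a c x y) (pimp (pbeta a c x y') (peq y y')))))))) MTA.
apply; [by []| |exact: (fun=> azero M)].
by move=> e a1 c1 x1 y1 y1' /beta_mod h /beta_mod h'; exact: etrans h (esym h').
Qed.

Lemma has_internal_cardE a n :
  has_internal_card (coded_set a) n <-> card_in W b a n.
Proof.
split=> [[u [v [f [fP [fim finj fsurj]]]]]|[u [v [Aim [Asurj Ainj]]]]].
  exists u, v; split=> [x xW xa|].
    by exists (f x); split; [apply: fim|apply: fP].
  split=> [y yn|x x' y xW xW' xa xa' xy xy'].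
    by have [x [xW xa] <-] := fsurj y yn; exists x; split=> //; split=> //; apply: fP.
  apply: finj; rewrite ?inE//.
  by rewrite (beta_unique (fP x _) xy)// (beta_unique (fP x' _) xy').
have /choice[f fP] : forall x, exists y, coded_set a x -> alt y n /\ beta u v x y.
  move=> x; have [[xW xa]|?] := pselect (coded_set a x); last by exists x.
  by have [y yP] := Aim x xW xa; exists y.
exists u, v, f; split; first by move=> x /fP[].
split=> [x /fP[]//|x x' /set_mem xa /set_mem xa' fxx'|y /Asurj[x [xW [xa xy]]]].
  have [xW ax] := xa; have [xW' ax'] := xa'.
  apply: (Ainj x x' (f x)) => //; first by have [] := fP x xa.
  by rewrite fxx'; have [] := fP x' xa'.
by exists x => //; have [|_ /beta_unique] := fP x; [|apply].
Qed.

Lemma internal_cardE a n : card_in W b a n -> internal_card (coded_set a) = n.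
Proof.
move=> an; rewrite /internal_card; case: xgetP => [n' -> /= /has_internal_cardE|].
  by have [_ [_ [_ [_ [h _]]]]] := bP; move=> /h; apply.
by move=> /(_ n) /= []; apply/has_internal_cardE.
Qed.

Lemma coded_cardP A : F A -> exists a n, A = coded_set a /\ card_in W b a n.
Proof.
move=> /coded_subsetsP[a ->]; exists a.
by have [_ [_ [_ [+ _]]]] := bP => /(_ a)[n]; exists n.
Qed.

Lemma card_below : internal_card (below W) = W.
Proof.
have [_ [_ [[a [aP aW]] _]]] := bP.
rewrite -[RHS](internal_cardE aW); congr internal_card.
by apply/seteqP; split=> x //= => [xW|[]//]; split=> //; apply: aP.
Qed.

Lemma mu_coded a n : card_in W b a n -> mu (coded_set a) = st n.
Proof. by move=> an; rewrite /internal_measure card_below (internal_cardE an). Qed.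

Lemma cardU a a' a'' n n' n'' : coded_set a'' = coded_set a `|` coded_set a' ->
  coded_set a `&` coded_set a' = set0 ->
  card_in W b a n -> card_in W b a' n' -> card_in W b a'' n'' -> n'' = aadd n n'.
Proof.
move=> U D; have [_ [_ [_ [_ [_ [h _]]]]]] := bP; apply: h => x xW.
  have : coded_set a'' x <-> coded_set a x \/ coded_set a' x by rewrite U.
  by rewrite /coded_set /below /=; tauto.
move=> xa xa'; suff : (coded_set a `&` coded_set a') x by rewrite D.
by [].
Qed.

Lemma card_le a n : card_in W b a n -> ale n W.
Proof.
have [_ [_ [_ [leD _]]]] := arith_model MTA.
have FA : F (coded_set a) by apply/coded_subsetsP; exists a.
have [a' [n' [aE' an']]] := coded_cardP (codedD codedT FA).
have [a'' [n'' [aE'' an'']]] := coded_cardP codedT.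
move=> an; have W'' : n'' = W by rewrite -(internal_cardE an'') -aE'' card_below.
rewrite -W'' (cardU _ _ an an' an''); first by have [] := leD n n'.
  by rewrite -aE'' -aE' setDE setUIr setUCr setIT (setUidr (coded_subset FA)).
by rewrite -aE' setDE setICA setICr setI0.
Qed.

Lemma muU A B : F A -> F B -> A `&` B = set0 -> mu (A `|` B) = mu A + mu B.
Proof.
move=> FA FB; have [a [n [-> an]]] := coded_cardP FA.
have [a' [n' [-> an']]] := coded_cardP FB => AB.
have FU : F (coded_set a `|` coded_set a').
  by apply: codedU; apply/coded_subsetsP; [exists a|exists a'].
have [a'' [n'' [aE'' an'']]] := coded_cardP FU.
rewrite aE'' (mu_coded an) (mu_coded an') (mu_coded an'').
rewrite (cardU _ _ an an' an'')//; apply: stD => //.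
by rewrite -(cardU _ _ an an' an'')//; apply: card_le an''.
Qed.

Lemma muT : mu (below W) = 1.
Proof. by rewrite /internal_measure card_below st1. Qed.

Lemma mu_ge0 A : F A -> 0 <= mu A.
Proof.
move=> FA; have [a [n [-> an]]] := coded_cardP FA.
by rewrite (mu_coded an) st_ge0//; apply: card_le an.
Qed.

(** Every rational in [0, 1] is the standard part of some c / W, and every c below the internal
    cardinality of Z is the cardinality of a coded subset of Z. *)
Lemma mu_dense Z (r e : R) : F Z -> 0 <= r -> r <= mu Z -> 0 < e ->
  exists A, [/\ F A, A `<=` Z & `|mu A - r| < e].
Proof.
move=> FZ r0 rZ e0; have [a [n [ZE an]]] := coded_cardP FZ.
have muZ : mu Z = st n by rewrite ZE (mu_coded an).
(* [rational_between] wants r - e to be nonnegative; otherwise the empty set is already close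
   enough. *)
have [r_e|e_r] := ltP r e.
  exists set0; split=> //; first by rewrite -(setDv Z); apply: codedD.
  have -> : mu set0 = 0.
    have F0 : F set0 by rewrite -(setDv Z); apply: codedD.
    by have := muU F0 F0 (setI0 _); rewrite setU0 => h; lra.
  by rewrite sub0r normrN ger0_norm.
have [||k [l [l0 /andP[ke kr]]]] := @rational_between R (r - e) r.
- by rewrite subr_ge0.
- by rewrite ltrBlDr ltrDl.
have Z1 : mu Z <= 1.
  rewrite -muT; have FD := codedD codedT FZ.
  have -> : below W = Z `|` (below W `\` Z).
    by rewrite setDE setUIr setUCr setIT (setUidr (coded_subset FZ)).
  by rewrite muU// ?lerDl ?mu_ge0// setDE setICA setICr setI0.
have kl : (k <= l)%N.
  have : (k%:R / l%:R : R) <= 1 by rewrite (le_trans (ltW kr))// (le_trans rZ).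
  by rewrite ler_pdivrMr ?ltr0n// mul1r ler_nat.
have [c [cW stc]] := st_division R MTA Wns kl l0.
have [lt_total _] := arith_model MTA.
have [cn|nc] := lt_total c n; last first.
  have := st_mono R MTA Wns nc cW; rewrite stc -muZ => Zk.
  exists Z; split=> //.
  by rewrite ger0_norm ?subr_ge0//; lra.
have [_ [_ [_ [_ [_ [_ h]]]]]] := bP.
have [a' [a'Z a'c]] := h a n c an cn.
exists (coded_set a'); split.
- by apply/coded_subsetsP; exists a'.
- by rewrite ZE => x [xW xa']; split=> //; apply: a'Z.
by rewrite (mu_coded a'c) stc ltr_norml; apply/andP; split; lra.
Qed.

End CodedSets.

(** Variable 0 is the code of the unknown set A, variable 1 is W, variable 2 the modulus, and
    variable i + 3 the code of X i. With c the cardinality of A intersected with X i, the formula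
    places c / W strictly below m / n or at least at m / n. *)
Definition pcount_bound (upper : bool) (i m n : nat) : pformula :=
  let mem a x := pbeta a (pfree 2) x p0 in let W := pfree 1 in
  pex (fun z => pex (fun c =>
  pand (pall (fun y => pimp (plt y W)
    (pand (pimp (mem z y) (pand (mem (pfree 0) y) (mem (pfree i.+3) y)))
          (pimp (pand (mem (pfree 0) y) (mem (pfree i.+3) y)) (mem z y)))))
  (pand (pcard W (pfree 2) z c)
    (if upper then plt (pmul (pnum n) c) (pmul (pnum m) W)
     else ple (pmul (pnum m) W) (pmul (pnum n) c))))).

Section Saturation.
Variables (R : realType) (M : arith_structure) (W : M).
Hypothesis MTA : model_of_true_arithmetic M.
Hypothesis Wns : nonstandard W.
Hypothesis Msat : omega1_saturated M.

Local Notation F := (coded_subsets W).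
Local Notation mu := (internal_measure R W).
Local Notation st p := (st_ratio R p W).
Local Notation b := (set_modulus W MTA).
Local Notation C a := (coded_set W MTA a).

Definition bound_env (a : nat -> M) (k : nat) : M :=
  match k with 0 => W | 1 => b | i.+2 => a i end.

Lemma sat_count_bound (a : nat -> M) x upper i m n :
  let c := internal_card (C x `&` C (a i)) in
  sat (scons x (bound_env a)) (pcount_bound upper i m n 0) <->
  (if upper then alt (amul (numeral M n) c) (amul (numeral M m) W)
   else ale (amul (numeral M m) W) (amul (numeral M n) c)).
Proof.
move=> c; have [z [c' [zE zc']]] : exists z c',
    C x `&` C (a i) = C z /\ card_in W b z c'.
  by apply: coded_cardP; apply: codedI => //; apply/(coded_subsetsP W MTA); eexists.
have cE : c' = c by rewrite /c zE (internal_cardE zc').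
have zP z' : (forall y, alt y W ->
    (beta z' b y (azero M) -> beta x b y (azero M) /\ beta (a i) b y (azero M)) /\
    (beta x b y (azero M) /\ beta (a i) b y (azero M) -> beta z' b y (azero M))) <->
  C z' = C x `&` C (a i).
  split=> [h|h y yW].
    apply/seteqP; split=> y /=.
      by move=> [yW zy]; have [xy ay] := (h y yW).1 zy.
    by move=> [[yW xy] [_ ay]]; split=> //; apply: (h y yW).2.
  have : C z' y <-> (C x `&` C (a i)) y by rewrite h.
  by rewrite /coded_set /below /=; tauto.
have lE (e : nat -> M) d : sat e ((if upper
      then plt (pmul (pnum n) (pbound 1)) (pmul (pnum m) (pfree 1))
      else ple (pmul (pnum m) (pfree 1)) (pmul (pnum n) (pbound 1))) d) <->
    (if upper
     then alt (amul (numeral M n) (e (d - 2)%N)) (amul (numeral M m) (e (d + 1)%N))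
     else ale (amul (numeral M m) (e (d + 1)%N)) (amul (numeral M n) (e (d - 2)%N))).
  by case: (upper) => /=; rewrite !teval_pnum.
split=> [[z' [c'' [/zP z'E [z'c'' /lE]]]]|h].
  suff -> : c'' = c by [].
  by rewrite /c -z'E (internal_cardE z'c'').
exists z, c'; split; first by apply/zP.
by split=> //; apply/lE; rewrite cE.
Qed.

(** The type puts [mu (A]&[X i)] on the same side as r i of every fraction different from r i.
    Finitely many of these conditions leave a positive margin, within which the approximations
    realize them. *)
Lemma model_saturation (X : nat -> set M) (r : nat -> R) :
  (forall i, F (X i)) ->
  (forall K e, 0 < e -> exists A, F A /\
    forall i, (i < K)%N -> `|mu (A `&` X i) - r i| < e) ->
  exists A, F A /\ forall i, mu (A `&` X i) = r i.
Proof.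
move=> FX approx.
have /choice[a aE] i : exists a, X i = C a by apply/(coded_subsetsP W MTA).
have muE x i : mu (C x `&` C (a i)) = st (internal_card (C x `&` C (a i))).
  by rewrite /internal_measure (card_below W MTA).
have FC x : F (C x) by apply/(coded_subsetsP W MTA); exists x.
have leW x i : ale (internal_card (C x `&` C (a i))) W.
  have [z [c [-> zc]]] := coded_cardP MTA (codedI MTA (FC x) (FC (a i))).
  by rewrite (internal_cardE zc); apply: card_le zc.
pose Gamma : set aformula := [set p | exists upper i m n, [/\ (0 < n)%N,
  (if upper then r i < m%:R / n%:R else m%:R / n%:R < r i) &
  p = pcount_bound upper i m n 0]].
have [D finD DG|x xP] := Msat (e := bound_env a) (Gamma := Gamma).
  (* K bounds the indices that p may mention and, through 1 / (K + 1), also the precision that p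
     demands, so one number measures both. *)
  pose P K p := forall x, (forall i, (i < K)%N ->
    `|mu (C x `&` X i) - r i| < K.+1%:R^-1) -> sat (scons x (bound_env a)) p.
  have [p Dp|K KP] := @finite_uniform _ D P finD; last first.
    have [|A [FA AP]] := approx K (K.+1%:R^-1); first by rewrite invr_gt0 ltr0n.
    have [x xA] : exists x, A = C x by apply/(coded_subsetsP W MTA).
    by exists x => p Dp; apply: (KP p Dp) => i iK; rewrite -xA; apply: AP.
  have [upper [i [m [n [n0 rmn ->]]]]] := DG _ Dp.
  pose d := `|r i - m%:R / n%:R|.
  have d0 : 0 < d.
    rewrite normr_gt0 subr_eq0; case: (upper) rmn => h;
    by rewrite ?(lt_eqF h) ?(gt_eqF h).
  exists (i + (Num.truncn d^-1).+1)%N => K iK x xK.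
  have Kd : K.+1%:R^-1 < d.
    rewrite -[ltRHS]invrK ltf_pV2 ?posrE ?invr_gt0// ?ltr0n//.
    have /andP[_ h] := truncn_itv (ltW (etrans (invr_gt0 d) d0)).
    apply: (lt_le_trans h); rewrite ler_nat.
    by apply: leqW; apply: leq_trans iK; rewrite leq_addl.
  have {xK} : `|mu (C x `&` X i) - r i| < d.
    apply: lt_trans Kd; apply: xK; apply: leq_trans iK.
    by rewrite addnS ltnS leq_addr.
  rewrite aE muE /d ltr_norml => /andP[xd dx]; apply/sat_count_bound.
  move: xd dx; case: (upper) rmn => /= rmn.
    by rewrite ltr0_norm ?subr_lt0// => _ h; apply: (st_lt (R := R)) => //; lra.
  by rewrite gtr0_norm ?subr_gt0// => h _; apply: (lt_st (R := R)) => //; lra.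
exists (C x); split=> [//|i].
have r0 : 0 <= r i.
  rewrite leNgt; apply/negP => ri0.
  have [|A [FA]] := approx i.+1 (- r i); first by rewrite oppr_gt0.
  move=> /(_ i (ltnSn i)); have := mu_ge0 R MTA Wns (codedI MTA FA (FX i)).
  by move=> h; rewrite ger0_norm; lra.
apply/eqP; rewrite aE muE eq_le; apply/andP; split; rewrite leNgt; apply/negP.
  move=> /(rational_between r0)[m [n [n0 /andP[rm ms]]]].
  have : Gamma (pcount_bound true i m n 0) by exists true, i, m, n.
  move/xP/sat_count_bound => /= h.
  have [_ [ltle _]] := arith_model MTA; apply: ltle h _.
  by apply: (lt_st (R := R)).
have s0 : 0 <= st (internal_card (C x `&` C (a i))) by apply: st_ge0.
move=> /(rational_between s0)[m [n [n0 /andP[sm mr]]]].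
have : Gamma (pcount_bound false i m n 0) by exists false, i, m, n.
move/xP/sat_count_bound => /= h.
by have := le_st R MTA Wns (leW x i) n0 h; rewrite leNgt sm.
Qed.

End Saturation.

(** * Probability algebras of sets and partial isomorphisms *)

(** The common ground of the coded sets and the measurable subsets of 2^K: finite additivity only,
    with the Boolean operations derived from differences and the top. *)
Definition prob_algebra (R : realType) (X : Type) (top : set X)
    (F : set (set X)) (mu : set X -> R) : Prop :=
  [/\ F top, (forall A, F A -> A `<=` top),
      (forall A B, F A -> F B -> F (A `\` B)),
      (forall A, F A -> 0 <= mu A) /\
        mu top = 1 &
      (forall A B, F A -> F B -> A `&` B = set0 -> mu (A `|` B) = mu A + mu B)].

Section ProbAlgebra.
Variables (R : realType) (X : Type) (top : set X) (F : set (set X)).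
Variable mu : set X -> R.
Hypothesis P : prob_algebra top F mu.

Lemma alg_T : F top. Proof. by case: P. Qed.
Lemma alg_top A : F A -> A `<=` top. Proof. by case: P => _ h _ _ _; apply: h. Qed.
Lemma alg_D A B : F A -> F B -> F (A `\` B).
Proof. by case: P => _ _ h _ _ ; apply: h. Qed.
Lemma alg_ge0 A : F A -> 0 <= mu A. Proof. by case: P => _ _ _ [h _] _; apply: h. Qed.
Lemma alg_muU A B : F A -> F B -> A `&` B = set0 -> mu (A `|` B) = mu A + mu B.
Proof. by case: P => _ _ _ _ h; apply: h. Qed.
Lemma alg_muT : mu top = 1. Proof. by case: P => _ _ _ []. Qed.

Lemma alg_I A B : F A -> F B -> F (A `&` B).
Proof. by move=> FA FB; rewrite -setDD; do 2?apply: alg_D. Qed.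

Lemma alg_0 : F set0.
Proof. by rewrite -(setDv top); apply: alg_D; apply: alg_T. Qed.

Lemma alg_UE A B : F A -> F B -> A `|` B = top `\` ((top `\` A) `\` B).
Proof.
move=> FA FB; apply/seteqP; split=> x /=.
  move=> AB; split; first by case: AB; apply: alg_top.
  by move=> [[_ nA] nB]; case: AB.
by move=> [xW nAB]; apply: contrapT => /not_orP[nA nB]; apply: nAB.
Qed.

Lemma alg_U A B : F A -> F B -> F (A `|` B).
Proof.
move=> FA FB; rewrite alg_UE//; do !apply: alg_D => //; exact: alg_T.
Qed.

Lemma alg_Y A B : F A -> F B -> F (A `+` B).
Proof. by move=> FA FB; apply: alg_U; apply: alg_D. Qed.

Lemma alg_mu0 : mu set0 = 0.
Proof. by have := alg_muU alg_0 alg_0 (setI0 _); rewrite setU0 => h; lra. Qed.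

Lemma alg_split A B : F A -> F B -> mu A = mu (A `&` B) + mu (A `\` B).
Proof.
move=> FA FB; rewrite -alg_muU; [|exact: alg_I|exact: alg_D|].
  by rewrite setUIDK.
by rewrite setDE setIACA setICr setI0.
Qed.

Lemma alg_mono A B : F A -> F B -> A `<=` B -> mu A <= mu B.
Proof.
move=> FA FB AB; rewrite (alg_split FB FA) (setIidr AB) lerDl.
exact/alg_ge0/alg_D.
Qed.

Lemma alg_le1 A : F A -> mu A <= 1.
Proof.
by move=> FA; rewrite -alg_muT; apply: alg_mono; [|exact: alg_T|exact: alg_top].
Qed.

Lemma alg_leU A B : F A -> F B -> mu (A `|` B) <= mu A + mu B.
Proof.
move=> FA FB; have -> : A `|` B = A `|` (B `\` A).
  by apply/seteqP; split=> x /=; have [] := pselect (A x); tauto.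
rewrite alg_muU//; [|exact: alg_D|by rewrite setDE setICA setICr setI0].
by rewrite lerD2l; apply: alg_mono => //; apply: alg_D.
Qed.

Lemma alg_muY A B : F A -> F B -> mu (A `+` B) = mu (A `\` B) + mu (B `\` A).
Proof.
move=> FA FB; apply: alg_muU; [exact: alg_D..|].
by apply/seteqP; split=> x //= -[[]] ? ? [].
Qed.

Lemma alg_Y_le A B C : F A -> F B -> F C -> mu (A `+` C) <= mu (A `+` B) + mu (B `+` C).
Proof.
move=> FA FB FC; apply: le_trans (alg_leU _ _); do ?exact: alg_Y.
apply: alg_mono; [exact: alg_Y|by apply: alg_U; apply: alg_Y|].
by move=> x; rewrite /setY /=; have [] := pselect (B x); tauto.
Qed.

Lemma alg_dist A B : F A -> F B -> `|mu A - mu B| <= mu (A `+` B).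
Proof.
move=> FA FB; rewrite alg_muY// (alg_split FA FB) (alg_split FB FA) (setIC B A).
have := alg_ge0 (alg_D FA FB); have := alg_ge0 (alg_D FB FA).
by rewrite ler_norml => ? ?; apply/andP; split; lra.
Qed.

Lemma alg_null_mono A B : F A -> F B -> A `<=` B -> mu B = 0 -> mu A = 0.
Proof.
move=> FA FB AB B0; apply/eqP; rewrite eq_le alg_ge0// andbT -B0.
exact: alg_mono.
Qed.

Lemma alg_nullU A B : F A -> F B -> mu A = 0 -> mu B = 0 -> mu (A `|` B) = 0.
Proof.
move=> FA FB A0 B0; apply/eqP; rewrite eq_le alg_ge0 ?andbT; last exact: alg_U.
by have := alg_leU FA FB; rewrite A0 B0 addr0.
Qed.

Local Notation Q := (null_quotient top F mu).
Local Notation cl := (null_class F mu).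

Lemma null_classP A B : F A -> F B -> cl A = cl B <-> mu (A `+` B) = 0.
Proof.
have cl_sub A' B' : F A' -> F B' -> mu (A' `+` B') = 0 -> cl A' `<=` cl B'.
  move=> FA FB AB C [FC CA]; split=> //;
    apply: (alg_null_mono _ _ _ (alg_nullU _ _ AB CA));
    do ?[exact: alg_Y|exact: (alg_U (alg_Y _ _) (alg_Y _ _))].
  by move=> x; rewrite /setY /=; have [] := pselect (A' x); tauto.
move=> FA FB; split=> [AB|AB]; last first.
  by apply/seteqP; split; apply: cl_sub; rewrite // setYC.
have : cl B B by split=> //; rewrite setYK alg_mu0.
by rewrite -AB => -[].
Qed.

Lemma null_class_refl A : F A -> cl A A.
Proof. by move=> FA; split=> //; rewrite setYK alg_mu0. Qed.

(** Such an operation does not increase symmetric differences, so all representatives give the same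
    class and the union over them collapses to it. *)
Lemma null_class_op (op : set X -> set X) : (forall A, F A -> F (op A)) ->
  (forall A B, op A `+` op B `<=` A `+` B) ->
  forall A, F A -> \bigcup_(B in cl A) cl (op B) = cl (op A).
Proof.
move=> Fop opY A FA; apply/seteqP; split=> [C [B [FB AB]]|C hC]; last first.
  by exists A => //; apply: null_class_refl.
suff -> : cl (op B) = cl (op A) by [].
apply/null_classP; [exact: Fop..|].
apply: (alg_null_mono _ _ (opY _ _)); [by apply: alg_Y; apply: Fop|exact: alg_Y|].
by rewrite setYC.
Qed.

Lemma null_class_op2 (op : set X -> set X -> set X) :
  (forall A B, F A -> F B -> F (op A B)) ->
  (forall A A' B B', op A B `+` op A' B' `<=` (A `+` A') `|` (B `+` B')) ->
  forall A B, F A -> F B ->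
  \bigcup_(A' in cl A) \bigcup_(B' in cl B) cl (op A' B') = cl (op A B).
Proof.
move=> Fop opY A B FA FB.
apply/seteqP; split=> [C [A' [FA' AA'] [B' [FB' BB']]]|C hC]; last first.
  by exists A; [|exists B => //]; apply: null_class_refl.
suff -> : cl (op A' B') = cl (op A B) by [].
apply/null_classP; [exact: Fop..|].
apply: (alg_null_mono _ _ (opY _ _ _ _)); [by apply: alg_Y; apply: Fop| |].
  by apply: alg_U; apply: alg_Y.
by apply: alg_nullU; do ?exact: alg_Y; rewrite setYC.
Qed.

Lemma quotient_join A B : F A -> F B -> @bjoin _ Q (cl A) (cl B) = cl (A `|` B).
Proof.
apply: null_class_op2; first by move=> *; apply: alg_U.
by move=> A1 A' B1 B' x; rewrite /setY /=; tauto.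
Qed.

Lemma quotient_meet A B : F A -> F B -> @bmeet _ Q (cl A) (cl B) = cl (A `&` B).
Proof.
apply: null_class_op2; first by move=> *; apply: alg_I.
move=> A1 A' B1 B' x; rewrite /setY /=.
have [] := pselect (A1 x); have [] := pselect (A' x);
  by have [] := pselect (B1 x); have [] := pselect (B' x); tauto.
Qed.

Lemma quotient_compl A : F A -> @bcompl _ Q (cl A) = cl (top `\` A).
Proof.
apply: null_class_op; first by move=> *; apply: alg_D => //; apply: alg_T.
move=> A1 B x; rewrite /setY /=.
by have [] := pselect (A1 x); have [] := pselect (B x); tauto.
Qed.

Lemma quotient_mass A : F A -> @mass _ Q (cl A) = mu A.
Proof.
move=> FA; rewrite /=; case: xgetP => [r -> [B [FB AB] <-]|/(_ (mu A))[]].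
  apply/eqP; rewrite -subr_eq0 -normr_le0 -AB setYC; exact: alg_dist.
by exists A => //; apply: null_class_refl.
Qed.

Lemma quotient_le A B : F A -> F B -> @ble _ Q (cl A) (cl B) <-> mu (A `\` B) = 0.
Proof.
move=> FA FB; rewrite /ble quotient_meet// null_classP//; last exact: alg_I.
suff -> : (A `&` B) `+` A = A `\` B by [].
by apply/seteqP; split=> x; rewrite /setY /=; have [] := pselect (B x); tauto.
Qed.

End ProbAlgebra.

Lemma countable_enumeration (T : Type) (A : set T) (x0 : T) : A x0 -> countable A ->
  exists s : nat -> T, (forall i, A (s i)) /\ (forall x, A x -> exists i, s i = x).
Proof.
elim/Ppointed: T => T in A x0 *; first by rewrite emptyE_subdef.
move=> Ax0 /pcard_surjP[s s_surj].
exists (fun i => if pselect (A (s i)) then s i else x0); split=> [i|x Ax].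
  by case: pselect.
by have [i _ si] := s_surj x Ax; exists i; case: pselect => //; rewrite si.
Qed.

(** * Partial isomorphisms and their one-step extensions *)

Section PairAlgebra.
Variables (R : realType) (X Y : Type) (topX : set X) (topY : set Y).
Variables (F : set (set X)) (G : set (set Y)).
Variables (mu : set X -> R) (lam : set Y -> R).
Hypothesis PX : prob_algebra topX F mu.
Hypothesis PY : prob_algebra topY G lam.
Implicit Types p : set (set X * set Y).

(* A measure-preserving isomorphism between subalgebras, as the subalgebra of
   the product that is its graph. *)
Definition pair_algebra p : Prop :=
  [/\ p (topX, topY),
      (forall A B A' B', p (A, B) -> p (A', B') -> p (A `\` A', B `\` B')) &
      (forall A B, p (A, B) -> [/\ F A, G B & mu A = lam B])].

Lemma pair_algebraI p A B A' B' : pair_algebra p -> p (A, B) -> p (A', B') ->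
  p (A `&` A', B `&` B').
Proof.
move=> [_ pD _] pAB pAB'; rewrite -(setDD A) -(setDD B).
exact: (pD _ _ _ _ pAB (pD _ _ _ _ pAB pAB')).
Qed.

Lemma pair_algebraU p A B A' B' : pair_algebra p -> p (A, B) -> p (A', B') ->
  p (A `|` A', B `|` B').
Proof.
move=> [pT pD pP] pAB pAB'; have [FA GB _] := pP _ _ pAB.
have [FA' GB' _] := pP _ _ pAB'; rewrite (alg_UE PX)// (alg_UE PY)//.
exact: (pD _ _ _ _ pT (pD _ _ _ _ (pD _ _ _ _ pT pAB) pAB')).
Qed.

Lemma pair_algebra_trivial :
  pair_algebra [set u | u = (topX, topY) \/ u = (set0, set0)].
Proof.
split; first by left.
- by move=> A B A' B' [] [-> ->] [] [-> ->]; rewrite /= ?setDv ?setD0 ?set0D; tauto.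
move=> A B [] [-> ->].
  by split; [exact: alg_T PX|exact: alg_T PY|rewrite (alg_muT PX) (alg_muT PY)].
by split; [exact: alg_0 PX|exact: alg_0 PY|rewrite (alg_mu0 PX) (alg_mu0 PY)].
Qed.

(** The general element of the algebra generated by p and (A, B): it agrees with one member of p
    inside A and with another one outside. *)
Definition adjoin (A : set X) (B : set Y) p : set (set X * set Y) :=
  [set ((A `&` u.1.1) `|` (u.2.1 `\` A), (B `&` u.1.2) `|` (u.2.2 `\` B)) |
    u in p `*` p].

Lemma sub_adjoin A B p : p `<=` adjoin A B p.
Proof.
move=> [U V] pUV; exists ((U, V), (U, V)) => //=.
have E T (C D : set T) : C `&` D `|` D `\` C = D by rewrite setIC setUIDK.
by rewrite !E.
Qed.

Lemma adjoin_mem A B p : pair_algebra p -> F A -> G B -> adjoin A B p (A, B).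
Proof.
move=> [pT pD _] FA GB; exists ((topX, topY), (set0, set0)).
  by split=> //=; rewrite -(setDv topX) -(setDv topY); apply: pD.
rewrite /= !set0D !setU0.
by rewrite (setIidl (alg_top PX FA)) (setIidl (alg_top PY GB)).
Qed.

Lemma adjoin_countable A B p : countable p -> countable (adjoin A B p).
Proof.
by move=> cp; apply: sub_countable (card_image_le _ _) _; apply: countableX.
Qed.

(** Matching the measures inside A is enough: outside they follow by subtraction, as both sides of a
    pair in p have equal measure. *)
Lemma adjoin_algebra A B p : pair_algebra p -> F A -> G B ->
  (forall U V, p (U, V) -> mu (A `&` U) = lam (B `&` V)) ->
  pair_algebra (adjoin A B p).
Proof.
move=> [pT pD pP] FA GB AB; split; first exact: sub_adjoin.
- move=> A1 B1 A2 B2 [[[U V] [U' V']] [/= pUV pUV'] [<- <-]]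
    [[[S T] [S' T']] [/= pST pST'] [<- <-]].
  exists ((U `\` S, V `\` T), (U' `\` S', V' `\` T')) => /=.
    by split; apply: pD.
  have E Z (C D D' H H' : set Z) : C `&` (D `\` H) `|` (D' `\` H') `\` C =
    (C `&` D `|` D' `\` C) `\` (C `&` H `|` H' `\` C).
    by apply/seteqP; split=> x /=; have [] := pselect (C x); tauto.
  by rewrite !E.
move=> _ _ [[[U V] [U' V']] [/= pUV pUV'] [<- <-]].
have [FU GV _] := pP _ _ pUV; have [FU' GV' UV'] := pP _ _ pUV'.
have disj Z (C D D' : set Z) : (C `&` D) `&` (D' `\` C) = set0.
  by apply/seteqP; split=> x //= [[? ?] []].
split.
- by apply: (alg_U PX); [apply: (alg_I PX)|apply: (alg_D PX)].
- by apply: (alg_U PY); [apply: (alg_I PY)|apply: (alg_D PY)].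
rewrite (alg_muU PX) ?disj//; [|exact: (alg_I PX)|exact: (alg_D PX)].
rewrite (alg_muU PY) ?disj//; [|exact: (alg_I PY)|exact: (alg_D PY)].
have := alg_split PX FU' FA; have := alg_split PY GV' GB.
by rewrite (AB _ _ pUV) UV' (setIC U') (setIC V') (AB _ _ pUV') => -> /addrI ->.
Qed.

(** The approximation is proved relative to an arbitrary piece (Z, W) of p, by induction on the
    number K of sets to be respected. Cutting the piece by the last set gives two disjoint problems,
    each solved within e / 2, whose solutions are united. Density enters only for uncut pieces, and
    saturation only in turning approximate equalities into exact ones. *)
Lemma extend_left p B : pair_algebra p -> countable p -> G B ->
  (forall Z (r e : R), F Z -> 0 <= r -> r <= mu Z -> 0 < e ->
     exists A, [/\ F A, A `<=` Z & `|mu A - r| < e]) ->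
  (forall (U : nat -> set X) (r : nat -> R), (forall i, F (U i)) ->
    (forall K e, 0 < e -> exists A, F A /\
      forall i, (i < K)%N -> `|mu (A `&` U i) - r i| < e) ->
    exists A, F A /\ forall i, mu (A `&` U i) = r i) ->
  exists A, F A /\ forall U V, p (U, V) -> mu (A `&` U) = lam (B `&` V).
Proof.
move=> Pp cp GB dense saturated; have [pT pD pP] := Pp.
have [s [ps s_surj]] := countable_enumeration pT cp.
pose U i := (s i).1; pose V i := (s i).2.
have pUV i : p (U i, V i) by rewrite /U /V -surjective_pairing.
have FU i : F (U i) by have [] := pP _ _ (pUV i).
have GV i : G (V i) by have [] := pP _ _ (pUV i).
suff approx K Z W e : p (Z, W) -> 0 < e -> exists A, [/\ F A, A `<=` Z,
    `|mu A - lam (B `&` W)| < e &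
    forall i, (i < K)%N -> `|mu (A `&` U i) - lam ((B `&` W) `&` V i)| < e].
  have [i|K e e0|A [FA AP]] := saturated U (fun i => lam (B `&` V i)).
  - exact: FU.
  - have [A [FA _ _ AP]] := approx K _ _ _ pT e0; exists A; split=> // i /AP.
    by rewrite (setIidl (alg_top PY GB)).
  exists A; split=> // U' V' /s_surj[i si].
  by have := AP i; rewrite /U /V si.
elim: K Z W e => [|K IH] Z W e pZW e0.
  have [FZ GW ZW] := pP _ _ pZW.
  have [||//|A [FA AZ Ae]] := dense Z (lam (B `&` W)) e FZ.
  - by apply: (alg_ge0 PY); apply: (alg_I PY).
  - rewrite ZW; apply: (alg_mono PY) => //; first exact: (alg_I PY).
  by exists A.
have e20 : 0 < e / 2 by rewrite divr_gt0.
have [FZ GW ZW] := pP _ _ pZW.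
have pI := pair_algebraI Pp pZW (pUV K); have pDD := pD _ _ _ _ pZW (pUV K).
have [A [FA AZ Ae AP]] := IH _ _ _ pI e20.
have [A' [FA' AZ' Ae' AP']] := IH _ _ _ pDD e20.
have GBW : G (B `&` W) by apply: (alg_I PY).
have AA' : A `&` A' = set0.
  by apply/seteqP; split=> x //= [/AZ[_ xU] /AZ'[_ []]].
have muE C : F C -> mu ((A `|` A') `&` C) = mu (A `&` C) + mu (A' `&` C).
  move=> FC; rewrite setIUl (alg_muU PX)//; [exact: (alg_I PX)..|].
  by rewrite setIACA AA' set0I.
have lamE C : G C -> lam ((B `&` W) `&` C) =
    lam ((B `&` (W `&` V K)) `&` C) + lam ((B `&` (W `\` V K)) `&` C).
  move=> GC; have GI : G ((B `&` W) `&` C) by apply: (alg_I PY).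
  rewrite (alg_split PY GI (GV K)).
  by congr (lam _ + lam _); apply/seteqP; split=> x /=; tauto.
exists (A `|` A'); split; first exact: (alg_U PX).
- by move=> x [/AZ[]|/AZ'[]].
- have -> : lam (B `&` W) =
      lam (B `&` (W `&` V K)) + lam (B `&` (W `\` V K)).
    rewrite (alg_split PY GBW (GV K)).
    by congr (lam _ + lam _); apply/seteqP; split=> x /=; tauto.
  rewrite (alg_muU PX)// [X in _ < X]splitr opprD addrACA.
  exact: le_lt_trans (ler_normD _ _) (ltrD Ae Ae').
move=> i; rewrite ltnS leq_eqVlt => /orP[/eqP ->|iK]; last first.
  rewrite muE// lamE// [X in _ < X]splitr opprD addrACA.
  exact: le_lt_trans (ler_normD _ _) (ltrD (AP i iK) (AP' i iK)).
rewrite muE// (setIidl (_ : A `<=` U K)); last by move=> x /AZ[].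
have -> : A' `&` U K = set0 by apply/seteqP; split=> x //= [/AZ'[]].
rewrite (alg_mu0 PX) addr0 -setIA; apply: lt_trans Ae _.
by rewrite ltr_pdivrMr// ltr_pMr// ltr1n.
Qed.

(** The class of A goes to the class of any partner of A. Surjectivity survives if sets on the right
    have a partner only up to a null set. *)
Lemma quotient_isomorphic p : pair_algebra p ->
  (forall A, F A -> exists B, p (A, B)) ->
  (forall B, G B -> exists A B', p (A, B') /\ lam (B `+` B') = 0) ->
  measure_algebra_isomorphic (null_quotient topX F mu) (null_quotient topY G lam).
Proof.
move=> Pp totX totY; have [pT pD pP] := Pp.
pose phi (a : set (set X)) : set (set Y) :=
  \bigcup_(u in [set u | p u /\ a u.1]) null_class G lam u.2.
(* Distances are preserved, which gives both that [phi] is well defined on classes and that it is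
   injective. *)
have pY A B A' B' : p (A, B) -> p (A', B') -> mu (A `+` A') = lam (B `+` B').
  move=> pAB pAB'; suff /pP[] : p (A `+` A', B `+` B') by [].
  by apply: pair_algebraU => //; apply: pD.
have phiE A B : p (A, B) -> phi (null_class F mu A) = null_class G lam B.
  move=> pAB; have [FA GB _] := pP _ _ pAB.
  apply/seteqP; split=> [C [[A' B'] [/= pAB' [FA' AA']]]|C BC]; last first.
    by exists (A, B) => //; split=> //=; apply: (null_class_refl PX).
  have [_ GB' _] := pP _ _ pAB'.
  suff -> : null_class G lam B' = null_class G lam B by [].
  by apply/(null_classP PY) => //; rewrite setYC -(pY _ _ _ _ pAB pAB').
have eX x : @elts _ (null_quotient topX F mu) x ->
    exists A B, p (A, B) /\ x = null_class F mu A.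
  by move=> [A FA <-]; have [B pAB] := totX A FA; exists A, B.
exists phi; split.
- split.
  + move=> _ /eX[A [B [pAB ->]]]; rewrite (phiE _ _ pAB).
    by have [_ GB _] := pP _ _ pAB; exists B.
  + move=> x y /set_mem /eX[A [B [pAB ->]]] /set_mem /eX[A' [B' [pAB' ->]]].
    have [FA GB _] := pP _ _ pAB; have [FA' GB' _] := pP _ _ pAB'.
    rewrite (phiE _ _ pAB) (phiE _ _ pAB') => /(null_classP PY GB GB') BB'.
    by apply/(null_classP PX) => //; rewrite (pY _ _ _ _ pAB pAB').
  + move=> _ [B GB <-]; have [A [B' [pAB' BB']]] := totY B GB.
    have [FA GB' _] := pP _ _ pAB'.
    exists (null_class F mu A); first by exists A.
    by rewrite (phiE _ _ pAB'); apply/(null_classP PY) => //; rewrite setYC.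
- move=> _ _ /eX[A [B [pAB ->]]] /eX[A' [B' [pAB' ->]]].
  have [FA GB _] := pP _ _ pAB; have [FA' GB' _] := pP _ _ pAB'.
  rewrite (quotient_join PX)// (phiE _ _ pAB) (phiE _ _ pAB') (quotient_join PY)//.
  exact: phiE (pair_algebraU Pp pAB pAB').
- move=> _ _ /eX[A [B [pAB ->]]] /eX[A' [B' [pAB' ->]]].
  have [FA GB _] := pP _ _ pAB; have [FA' GB' _] := pP _ _ pAB'.
  rewrite (quotient_meet PX)// (phiE _ _ pAB) (phiE _ _ pAB') (quotient_meet PY)//.
  exact: phiE (pair_algebraI Pp pAB pAB').
- move=> _ /eX[A [B [pAB ->]]]; have [FA GB _] := pP _ _ pAB.
  rewrite (quotient_compl PX)// (phiE _ _ pAB) (quotient_compl PY)//.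
  exact: phiE (pD _ _ _ _ pT pAB).
move=> _ /eX[A [B [pAB ->]]]; have [FA GB AB] := pP _ _ pAB.
by rewrite (phiE _ _ pAB) (quotient_mass PX)// (quotient_mass PY)// AB.
Qed.

End PairAlgebra.

(** * The product measure *)

Section Averaging.
Variables (R : realType) (K : choiceType).
Implicit Types (f g : K -> bool) (h : (K -> bool) -> R) (s : seq K).

Definition update (k : K) (b : bool) f : K -> bool :=
  fun j => if j == k then b else f j.

(** Integration over one fair coin. On functions of finitely many coordinates, iterating it over
    them is integration against the product measure. *)
Definition average (k : K) h : (K -> bool) -> R :=
  fun f => (h (update k true f) + h (update k false f)) / 2.

Definition averages s h := foldr average h s.

Definition depends_on (S : pred K) (T : Type) (h : (K -> bool) -> T) :=
  forall f g, (forall k, S k -> f k = g k) -> h f = h g.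

Lemma averageC j k h : average j (average k h) = average k (average j h).
Proof.
have [->//|jk] := eqVneq j k.
apply/funext => f; rewrite /average.
have E b c : update k b (update j c f) = update j c (update k b f).
  apply/funext => i; rewrite /update.
  by case: eqP => // ->; rewrite eq_sym (negbTE jk).
rewrite !E; lra.
Qed.

Lemma averages_average s j h : averages s (average j h) = average j (averages s h).
Proof. by elim: s => //= k s ->; rewrite averageC. Qed.

Lemma averagesC s t h : averages s (averages t h) = averages t (averages s h).
Proof. by elim: s => //= k s ->; rewrite averages_average. Qed.

Lemma averages_cst s (c : R) : averages s (fun=> c) = fun=> c.
Proof. by elim: s => //= k s ->; apply/funext => f; rewrite /average; lra. Qed.

Lemma averagesD s h h' : averages s (fun f => h f + h' f) =
  (fun f => averages s h f + averages s h' f).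
Proof.
by elim: s => //= k s ->; apply/funext => f; rewrite /average; lra.
Qed.

Lemma averages_ge0 s h : (forall f, 0 <= h f) -> forall f, 0 <= averages s h f.
Proof.
by move=> h0; elim: s => //= k s IH f; rewrite /average divr_ge0// addr_ge0.
Qed.

Lemma averagesM s (u : (K -> bool) -> R) h : depends_on (fun k => k \notin s) u ->
  averages s (fun f => u f * h f) = (fun f => u f * averages s h f).
Proof.
elim: s => //= k s IH uD; rewrite IH; last first.
  move=> f g fg; apply: uD => j jks; apply: fg; apply: contra jks.
  by rewrite in_cons => ->; rewrite orbT.
apply/funext => f; rewrite /average.
have uE b : u (update k b f) = u f.
  by apply: uD => j; rewrite in_cons negb_or /update => /andP[/negbTE ->].
by rewrite !uE -mulrDr mulrA.
Qed.

Lemma averages_depends S s h : depends_on S h ->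
  depends_on (fun k => S k && (k \notin s)) (averages s h).
Proof.
elim: s => [|k s IH] hS f g fg /=.
  by apply: hS => k Sk; apply: fg; rewrite Sk.
rewrite /average; congr ((_ + _) / _); apply: IH => // j /andP[Sj js];
  rewrite /update; case: eqP => // /eqP jk; apply: fg;
  by rewrite Sj in_cons negb_or jk.
Qed.

Lemma averages_support s h f g : depends_on [in s] h ->
  averages s h f = averages s h g.
Proof.
by move=> hs; apply: (averages_depends hs) => k; rewrite /= andbN.
Qed.

(** Averaging over s already makes h constant, so averaging over t afterwards changes nothing; the
    same holds with s and t exchanged, and the averages commute. *)
Lemma averages_uniq_value s t h f g : depends_on [in s] h ->
  depends_on [in t] h -> averages s h f = averages t h g.
Proof.
move=> hs ht.
have sE : averages s h = fun=> averages s h f.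
  by apply/funext => f'; apply: averages_support.
have tE : averages t h = fun=> averages t h g.
  by apply/funext => f'; apply: averages_support.
have : averages t (averages s h) f = averages s (averages t h) f.
  by rewrite averagesC.
by rewrite [averages s h]sE [averages t h]tE !averages_cst.
Qed.

Lemma averages_pattern s (b : K -> bool) f : uniq s ->
  averages s (fun g => (all (fun k => g k == b k) s)%:R) f = 2^-1 ^+ size s.
Proof.
elim: s f => [f _|k s IH f /= /andP[ks us]]; first by rewrite expr0.
rewrite (_ : (fun g => _) = fun g : K -> bool => (g k == b k)%:R *
  (all (fun k => g k == b k) s)%:R); last first.
  by apply/funext => g; rewrite -natrM mulnb.
rewrite averagesM; last by move=> f' g' /(_ k ks) ->.
rewrite /average !IH// /update eqxx exprS.
by case: (b k) => /=; rewrite ?mul1r ?mul0r ?addr0 ?add0r mulrC.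
Qed.

Definition clopen (A : set (K -> bool)) := exists s, depends_on [in s] A.

Definition charfun (A : set (K -> bool)) f : R := (`[< A f >])%:R.

(** The list of coordinates is an arbitrary choice and so is the point of evaluation;
    [clopen_contentE] shows that neither matters. Sets that are not clopen get the junk value 0. *)
Definition clopen_content (A : set (K -> bool)) : \bar R :=
  (if pselect (clopen A) is left e then
    averages (projT1 (cid e)) (charfun A) (fun=> false) else 0)%:E.

Lemma clopen_contentE A s f : depends_on [in s] A ->
  clopen_content A = (averages s (charfun A) f)%:E.
Proof.
move=> sA; rewrite /clopen_content; case: pselect => [e|[]]; last by exists s.
have dep t : depends_on [in t] A -> depends_on [in t] (charfun A).
  by move=> tA g g' gg'; rewrite /charfun (tA _ _ gg').
by congr EFin; apply: averages_uniq_value; apply: dep => //; exact: projT2 (cid e).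
Qed.

Lemma depends_on_sub (S S' : pred K) (T : Type) (h : (K -> bool) -> T) :
  (forall k, S k -> S' k) -> depends_on S h -> depends_on S' h.
Proof. by move=> SS' hS f g fg; apply: hS => k /SS'/fg. Qed.

Lemma clopen_common A B : clopen A -> clopen B ->
  exists s, depends_on [in s] A /\ depends_on [in s] B.
Proof.
move=> [s sA] [t tB]; exists (s ++ t); split.
  by apply: depends_on_sub sA => k /=; rewrite mem_cat => ->.
by apply: depends_on_sub tB => k /=; rewrite mem_cat orbC => ->.
Qed.

Lemma clopen0 : clopen set0. Proof. by exists [::]. Qed.

Lemma clopenU : setU_closed clopen.
Proof.
move=> A B cA cB; have [s [sA sB]] := clopen_common cA cB.
by exists s => f g fg; rewrite /setU /mkset (sA _ _ fg) (sB _ _ fg).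
Qed.

Lemma clopenC : setC_closed clopen.
Proof.
by move=> A [s sA]; exists s => f g fg; rewrite /setC /mkset (sA _ _ fg).
Qed.

Lemma clopen_content0 : clopen_content set0 = 0%E.
Proof.
rewrite (@clopen_contentE _ [::] (fun=> false)) //=.
by rewrite /charfun asboolF.
Qed.

Lemma clopen_content_ge0 A : (0 <= clopen_content A)%E.
Proof.
rewrite /clopen_content; case: pselect => // e; by rewrite lee_fin averages_ge0.
Qed.

Lemma clopen_contentU A B : clopen A -> clopen B -> A `&` B = set0 ->
  (clopen_content (A `|` B) = clopen_content A + clopen_content B)%E.
Proof.
move=> cA cB AB; have [s [sA sB]] := clopen_common cA cB.
pose o : K -> bool := fun=> false.
rewrite (clopen_contentE o sA) (clopen_contentE o sB) (@clopen_contentE _ s o).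
  rewrite -EFinD; congr EFin; rewrite -[RHS]/((fun f => _ f + _ f) o) -averagesD.
  congr averages; apply/funext => f; rewrite /charfun.
  have := congr1 (fun X => X f) AB; rewrite /setI /setU /mkset /set0 /mkset => ABf.
  have [Af|nAf] := pselect (A f); have [Bf|nBf] := pselect (B f).
  - by have : False by rewrite -ABf.
  - rewrite (asboolT Af) (asboolF nBf) addr0 asboolT//; by left.
  - rewrite (asboolF nAf) (asboolT Bf) add0r asboolT//; by right.
  - by rewrite (asboolF nAf) (asboolF nBf) addr0 asboolF// => -[].
by move=> f g fg; rewrite /setU /mkset (sA _ _ fg) (sB _ _ fg).
Qed.

(** Compactness of 2^K: an ultrafilter containing all the B n decides every coordinate and so has a
    limit point. As B n depends on finitely many coordinates, some member of B n agrees with the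
    limit on them. *)
Lemma clopen_compact (B : nat -> set (K -> bool)) : (forall n, clopen (B n)) ->
  (forall m n, (m <= n)%N -> B n `<=` B m) -> (forall n, B n !=set0) ->
  exists f, forall n, B n f.
Proof.
move=> cB decr B0.
pose Fi : set_system (K -> bool) := [set A | exists n, B n `<=` A].
have FiP : ProperFilter Fi.
  split; first by move=> [n Bn]; have [f /Bn] := B0 n.
  split; first by exists 0%N.
    move=> A A' [m Bm] [n Bn]; exists (maxn m n) => f Bf; split.
      by apply/Bm/(decr _ _ (leq_maxl m n)).
    by apply/Bn/(decr _ _ (leq_maxr m n)).
  by move=> A A' AA' [n Bn]; exists n; apply: subset_trans AA'.
have [U [UU FU]] := ultraFilterLemma FiP.
have UP : ProperFilter U := @ultra_proper _ _ UU.
pose f k := `[< U [set g : K -> bool | g k] >].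
have Uf k : U [set g | g k = f k].
  rewrite /f; case: asboolP => [h|nUk].
    by apply: filterS h => g /= ->.
  have [//|] := in_ultra_setVsetC [set g : K -> bool | g k] UU.
  by apply: filterS => g /= /negP/negbTE.
exists f => n; have [s sB] := cB n.
have Us : U [set g | forall k, k \in s -> g k = f k].
  elim: (s) => [|k t IH]; first by apply: filterS filterT.
  apply: filterS (filterI (Uf k) IH) => g [gk gt] j.
  by rewrite in_cons => /orP[/eqP ->|/gt].
have UB : U (B n) by apply: FU; exists n.
have [g [Bg gs]] : exists g, B n g /\ forall k, k \in s -> g k = f k.
  by have [g []] := filter_ex (filterI UB Us); exists g.
by rewrite -(sB g f gs).
Qed.

End Averaging.

(** A second name for 2^K that carries the algebra of clopen sets, from which the measure is
    extended, while [cantor_space] carries the sigma-algebra. *)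
Definition clopen_space (K : choiceType) : Type := K -> bool.

Section CoinMeasure.
Variables (R : realType) (K : choiceType).

HB.instance Definition _ := Pointed.on (K -> bool).
HB.instance Definition _ := Pointed.copy (clopen_space K) (K -> bool).
HB.instance Definition _ := isAlgebraOfSets.Build default_measure_display
  (clopen_space K) (@clopen0 K) (@clopenU K) (@clopenC K).

Definition coin_content : set (clopen_space K) -> \bar R := @clopen_content R K.

Lemma coin_content_bigsetU (B : nat -> set (clopen_space K)) n :
  (forall i, clopen (B i)) -> trivIset setT B ->
  clopen (\big[setU/set0]_(i < n) B i) /\
  (coin_content (\big[setU/set0]_(i < n) B i) = \sum_(0 <= i < n) coin_content (B i))%E.
Proof.
move=> cB tB; elim: n => [|n [IHc IH]].
  by rewrite big_ord0 big_geq//; split; [exact: clopen0|exact: clopen_content0].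
rewrite big_ord_recr big_nat_recr//= -IH; split; first exact: clopenU.
apply: clopen_contentU => //.
by rewrite -(@bigcup_mkord _ n B) setI_bigcupl bigcup0// => i /= ni;
  move/trivIsetP : tB => -> //; rewrite neq_ltn ni.
Qed.

(** If a countable disjoint union of clopen sets is clopen, the remainders [D n] are clopen and
    decrease to the empty set. By compactness one of them is empty, so the sum is finite. *)
Lemma coin_content_sigma_additive : semi_sigma_additive coin_content.
Proof.
move=> B mB tB mU; pose U := \bigcup_n B n.
have cB n := (coin_content_bigsetU n mB tB).1.
pose D n := U `\` \big[setU/set0]_(i < n) B i.
have [N DN] : exists n, D n = set0.
  apply: contrapT => /forallNP D0.
  have [|m n mn|n|f fD] := @clopen_compact K D.
  - move=> n; rewrite /D setDE -[U]setCK -setCU; apply: clopenC.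
    by apply: clopenU => //; apply: clopenC.
  - apply: setDS; rewrite -!(@bigcup_mkord _ _ B) => f [i /= im Bf].
    by exists i => //=; apply: leq_trans mn.
  - by apply/set0P/eqP/D0.
  have [[i _ Bf] _] := fD 0%N; have [_ []] := fD i.+1.
  by rewrite -bigcup_mkord; exists i => /=.
apply: cvg_near_cst; exists N => // n /= Nn.
rewrite -(coin_content_bigsetU n mB tB).2; congr coin_content.
apply/seteqP; split; rewrite -bigcup_mkord.
  by apply: bigcup_sub => i _; apply: bigcup_sup.
move=> f Uf; have : ~ D N f by rewrite DN.
move=> /not_andP[//|/contrapT]; rewrite -bigcup_mkord => -[i /= iN Bf].
by exists i => //=; apply: leq_trans Nn.
Qed.

HB.instance Definition _ := isMeasure.Build _ _ _ coin_content
  (@clopen_content0 R K) (@clopen_content_ge0 R K) coin_content_sigma_additive.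

Definition coin_measure : set (cantor_space K) -> \bar R :=
  measure_extension coin_content.

Lemma cylinderE (t : {fmap K -> bool}) f : cylinder t f <->
  all (fun k => f k == odflt false t.[? k]%fmap) (domf t).
Proof.
split=> [h|/allP h k c kc].
  apply/allP => k kt; have := h k (odflt false t.[? k]%fmap).
  case: (fndP t k) => [kt' /(_ erefl) ->//|]; by rewrite kt.
have /h/eqP -> : k \in domf t by rewrite -fndSome kc.
by rewrite kc.
Qed.

Lemma cylinder_clopen (t : {fmap K -> bool}) : clopen (cylinder t).
Proof.
exists (domf t) => f g fg; apply/propext.
have kt k b : t.[? k]%fmap = Some b -> k \in domf t.
  by move=> h; rewrite -fndSome h.
by split=> h k b kb; rewrite -(h k b kb) (fg k (kt _ _ kb)).
Qed.

Lemma cantor_measurable (A : set (cantor_space K)) : measurable A ->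
  measurable (A : set (g_sigma_algebraType (@measurable _ (clopen_space K)))).
Proof.
apply: smallest_sub; first exact: smallest_sigma_algebra.
move=> _ [t _ <-]; apply: sub_sigma_algebra; exact: cylinder_clopen.
Qed.

Lemma coin_measure0 : coin_measure set0 = 0%E.
Proof. exact: measure0. Qed.

Lemma coin_measure_ge0 A : (0 <= coin_measure A)%E.
Proof. exact: measure_ge0. Qed.

Lemma coin_measure_sigma_additive : semi_sigma_additive coin_measure.
Proof.
move=> B mB tB mU; apply: measure_semi_sigma_additive => //.
- by move=> i; apply: cantor_measurable.
- exact: cantor_measurable.
Qed.

HB.instance Definition _ := isMeasure.Build _ _ _ coin_measure
  coin_measure0 coin_measure_ge0 coin_measure_sigma_additive.

Lemma coin_measure_cylinder (t : {fmap K -> bool}) :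
  coin_measure (cylinder t) = ((2^-1 : R) ^+ #|` domf t|)%:E.
Proof.
rewrite /coin_measure /measure_extension /= measurable_mu_extE /=; last first.
  exact: cylinder_clopen.
pose b k := odflt false t.[? k]%fmap.
have tE f : cylinder t f <-> all (fun k => f k == b k) (domf t) := cylinderE t f.
rewrite /coin_content (@clopen_contentE _ _ _ (domf t) (fun=> false)).
  rewrite -(@averages_pattern R _ (domf t) b (fun=> false) (fset_uniq _)).
  congr (averages _ _ _)%:E; apply/funext => f; rewrite /charfun.
  by congr (_ %:R); congr nat_of_bool; apply/asboolP/idP => /tE.
move=> f g fg; apply/propext; rewrite !tE.
by rewrite (@eq_in_all _ _ (fun k => g k == b k))// => k kt; rewrite fg.
Qed.

Lemma coin_measureT : coin_measure setT = 1%E.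
Proof.
have -> : setT = cylinder ([fmap] : {fmap K -> bool})%fmap.
  by apply/seteqP; split=> f // _ k b; rewrite fnd_fmap0.
by rewrite coin_measure_cylinder domf0 cardfs0 expr0.
Qed.

HB.instance Definition _ := Measure_isProbability.Build _ _ _ coin_measure
  coin_measureT.

(** [coin_measure] witnesses that the [xget] in [product_measure] does not fall back on its default,
    a Dirac measure. *)
Lemma product_measure_cylinder (t : {fmap K -> bool}) :
  product_measure R K (cylinder t) = ((2^-1 : R) ^+ #|` domf t|)%:E.
Proof.
rewrite /product_measure; case: xgetP => [lam -> -> //|/(_ coin_measure)[]].
exact: coin_measure_cylinder.
Qed.

End CoinMeasure.

(** * Coordinate flips and independent thresholds *)

Lemma infinite_sequence (T : Type) (A : set T) : infinite_set A ->
  exists c : nat -> T, injective c /\ forall n, A (c n).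
Proof.
elim/Ppointed: T => T in A *.
  by move=> []; rewrite emptyE_subdef; exact: finite_set0.
move=> /infiniteP /pcard_leP/unsquash c; exists c; split=> [m n cmn|n].
  by apply: (inj (f := c)); rewrite ?inE.
exact: funS.
Qed.

Section CantorMeasure.
Variables (R : realType) (K : choiceType).
Local Notation Z := (cantor_space K).
Local Notation "'mZ'" := (@measurable _ Z).

Definition cantor_measure (A : set (K -> bool)) : R := fine (product_measure R K A).
Local Notation lam := cantor_measure.

Lemma cantor_measureE (A : set Z) : mZ A -> (lam A)%:E = product_measure R K A.
Proof. by move=> mA; rewrite fineK// fin_num_measure. Qed.

Lemma cylinder0 : cylinder ([fmap] : {fmap K -> bool})%fmap = setT.
Proof. by apply/seteqP; split=> f // _ k b; rewrite fnd_fmap0. Qed.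

Lemma cylinder_measurable (t : {fmap K -> bool}) : mZ (cylinder t).
Proof. by apply: sub_sigma_algebra; exists t. Qed.

Lemma cantor_ind (P : set (set (K -> bool))) :
  (forall t, P (cylinder t)) -> (forall A, P A -> P (~` A)) ->
  (forall B : nat -> set (K -> bool), (forall n, P (B n)) -> P (\bigcup_n B n)) ->
  forall A : set Z, mZ A -> P A.
Proof.
move=> Pcyl PC PU; apply: smallest_sub; last by move=> _ [t _ <-]; apply: Pcyl.
split=> [|A /PC|B /PU//]; last by rewrite setTD.
by rewrite -setCT -cylinder0; apply: PC.
Qed.

Lemma cantor_prob_algebra :
  prob_algebra [set: K -> bool] (measurable : set (set Z)) lam.
Proof.
split=> //.
- by move=> A B; apply: measurableD.
- split=> [A mA|]; first by rewrite /lam fine_ge0.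
  by rewrite /lam probability_setT.
move=> A B mA mB AB; apply/EFin_inj.
by rewrite EFinD !cantor_measureE ?measureU//; apply: measurableU.
Qed.

Lemma cantor_bigcup_approx (B : nat -> set Z) (e : R) : (forall n, mZ (B n)) ->
  (forall n, B n `<=` B n.+1) -> 0 < e ->
  exists n, lam (\bigcup_n B n) < lam (B n) + e.
Proof.
move=> mB Bincr e0; apply: contrapT => /forallNP nB.
have mU : mZ (\bigcup_n B n) by exact: bigcupT_measurable.
have nd : nondecreasing_seq B.
  by apply/nondecreasing_seqP => n; apply/subsetPset/Bincr.
have cvB := nondecreasing_cvg_mu (mu := product_measure R K) mB mU nd.
suff : lam (\bigcup_n B n) <= lam (\bigcup_n B n) - e by rewrite lerBrDr gerDl leNgt e0.
rewrite -[leLHS]/(fine _) -lee_fin cantor_measureE// -(cvg_lim _ cvB)//.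
apply: lime_le; first by apply/cvg_ex; eexists; exact: cvB.
apply: nearW => n /=; rewrite -cantor_measureE// lee_fin lerBrDr.
by rewrite leNgt; apply/negP/nB.
Qed.

Lemma cantor_bigcup_le (B : nat -> set Z) (x : R) : (forall n, mZ (B n)) ->
  (forall n, B n `<=` B n.+1) -> (forall n, lam (B n) <= x) ->
  lam (\bigcup_n B n) <= x.
Proof.
move=> mB Bincr Bx; apply/ler_addgt0Pr => e e0.
have [n /ltW h] := cantor_bigcup_approx mB Bincr e0.
by apply: (le_trans h); rewrite lerD2r.
Qed.

Lemma cantor_bigcup (B : nat -> set Z) (x : R) : (forall n, mZ (B n)) ->
  (forall n, B n `<=` B n.+1) -> (forall n, lam (B n) <= x) ->
  (forall e, 0 < e -> exists n, x - e < lam (B n)) ->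
  lam (\bigcup_n B n) = x.
Proof.
move=> mB Bincr Bx xB; apply/eqP; rewrite eq_le cantor_bigcup_le//=.
have mU : mZ (\bigcup_n B n) by exact: bigcupT_measurable.
apply/ler_addgt0Pr => e /xB[n xn]; rewrite -lerBlDr; apply: (le_trans (ltW xn)).
by apply: (alg_mono cantor_prob_algebra) => //; exact: bigcup_sup.
Qed.

Definition flip (k : K) (f : K -> bool) : K -> bool :=
  fun j => if j == k then ~~ f j else f j.

Lemma flipK k : involutive (flip k).
Proof. by move=> f; apply/funext => j; rewrite /flip; case: eqP; rewrite ?negbK. Qed.

Definition flip_fmap k (t : {fmap K -> bool}) : {fmap K -> bool} :=
  if t.[? k]%fmap is Some b then t.[k <- ~~ b]%fmap else t.

Lemma flip_cylinder k t : flip k @^-1` cylinder t = cylinder (flip_fmap k t).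
Proof.
apply/seteqP; split=> f /= ft j b; rewrite /flip_fmap.
  case tk : (t.[? k]%fmap) => [c|] => [|tj]; last first.
    have := ft j b tj; rewrite /flip; case: eqP => // jk _.
    by move: tj; rewrite jk tk.
  rewrite fnd_set; case: eqP => [->[<-]|jk tj].
    by have := ft k c tk; rewrite /flip eqxx => <-; rewrite negbK.
  by have := ft j b tj; rewrite /flip; case: eqP.
rewrite /flip => tj; case: eqP => jk.
  have := ft k (~~ b); rewrite /flip_fmap -jk tj fnd_set eqxx => /(_ erefl) ->.
  by rewrite negbK.
apply: ft; rewrite /flip_fmap; case: (t.[? k]%fmap) => // c.
by rewrite fnd_set; case: eqP.
Qed.

Lemma flip_measurable k (A : set Z) : mZ A -> mZ (flip k @^-1` A).
Proof.
apply: (@cantor_ind [set A | mZ (flip k @^-1` A)]) => [t|B mB|B mB] /=.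
- by rewrite flip_cylinder; apply: cylinder_measurable.
- by rewrite preimage_setC; apply: measurableC.
- by rewrite preimage_bigcup; apply: bigcupT_measurable.
Qed.

(** The image of the measure under the flip has the same values on cylinders, which generate the
    sigma-algebra and are closed under intersection except for disjoint pairs. *)
Lemma flip_measure k (A : set Z) : mZ A -> lam (flip k @^-1` A) = lam A.
Proof.
move=> mA; have mf : measurable_fun [set: Z] (flip k : Z -> Z).
  by move=> _ B mB; rewrite setTI; apply: flip_measurable.
have [nu nuE] : exists nu : {measure set Z -> \bar R},
    nu = pushforward (product_measure R K) (flip k : Z -> Z) :> (set Z -> \bar R).
  by exists (measure_function_pushforward__canonical__measure_function_Measure
    (product_measure R K) mf).
(* The empty set is added because cylinders with conflicting conditions are disjoint. *)
pose G : set (set Z) := range (@cylinder K) `|` [set set0].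
rewrite /lam; congr fine.
rewrite -[LHS]/(pushforward (product_measure R K) (flip k : Z -> Z) A) -nuE.
apply/esym.
have := @measure_unique _ R Z G (fun=> setT) _ _ _ _ (product_measure R K) nu.
apply=> //.
- apply/seteqP; split; apply: smallest_sub; try exact: smallest_sigma_algebra.
    by move=> B [t _ tB]; apply: sub_sigma_algebra; left; exists t.
  move=> B [[t _ <-]|->]; [exact: cylinder_measurable|exact: measurable0].
- move=> B C [[t _ <-]|->]; last by rewrite set0I; right.
  move=> [[u _ <-]|->]; last by rewrite setI0; right.
  have [[f [ft fu]]|nf] := pselect (exists f, cylinder t f /\ cylinder u f).
    left; exists (catf t u) => //; apply/seteqP; split=> g.
      move=> gtu; split=> j b jb; apply: gtu; rewrite fnd_cat.
        case: ifP => // ju; rewrite -(ft _ _ jb) in_fnd; congr Some.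
        by rewrite (fu j u.[ju]%fmap)// in_fnd.
      by rewrite -fndSome jb.
    move=> [gt gu] j b; rewrite fnd_cat; case: ifP => _; [exact: gu|exact: gt].
  right; apply/seteqP; split=> f // [ft fu]; apply: nf; by exists f.
- by move=> _; left; exists ([fmap] : {fmap K -> bool})%fmap => //; exact: cylinder0.
- by apply/seteqP; split=> // f _; exists 0%N.
- move=> B [[t _ <-]|->]; last by rewrite !measure0.
  rewrite nuE /pushforward flip_cylinder product_measure_cylinder.
  apply: (etrans (product_measure_cylinder R t)).
  rewrite /flip_fmap; case tk : (t.[? k]%fmap) => [b|//].
  have kt : k \in domf t by rewrite -fndSome tk.
  by rewrite dom_setf mem_fset1U.
by move=> _; rewrite -ge0_fin_numE// fin_num_measure.
Qed.

Definition flip_invariant_off (J : set K) (A : set (K -> bool)) :=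
  forall k, ~ J k -> flip k @^-1` A = A.

(** Flip invariance is a weak form of depending on the coordinates in J only. It passes through
    complements and countable unions setwise and is enough for independence. *)
Lemma measurable_flip_invariant (A : set Z) : mZ A ->
  exists J, countable J /\ flip_invariant_off J A.
Proof.
apply: (@cantor_ind [set A | exists J, countable J /\ flip_invariant_off J A]).
- move=> t; exists [set` domf t]; split; first exact: countable_fset.
  move=> k /= kt; rewrite flip_cylinder /flip_fmap.
  by case tk : (t.[? k]%fmap) => [b|//]; case: kt; rewrite -fndSome tk.
- move=> A0 [J [cJ JA]]; exists J; split=> // k nk.
  exact: (congr1 (@setC (K -> bool)) (JA k nk)).
move=> B /choice[J JB]; exists (\bigcup_n J n); split.
  by apply: bigcup_countable => // n _; have [] := JB n.
move=> k nJk; rewrite preimage_bigcup; apply: eq_bigcupr => n _.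
by have [_ h] := JB n; apply: h => Jnk; apply: nJk; exists n.
Qed.

Definition coordinate (k : K) : set (K -> bool) := [set f | f k].

Lemma coordinateE k :
  coordinate k = cylinder ([fmap].[k <- true] : {fmap K -> bool})%fmap.
Proof.
apply/seteqP; split=> f /= fk.
  by move=> j b; rewrite fnd_set fnd_fmap0; case: eqP => // -> [<-].
by apply: fk; rewrite fnd_set eqxx.
Qed.

Lemma coordinate_measurable k : mZ (coordinate k).
Proof. by rewrite coordinateE; apply: cylinder_measurable. Qed.

(** The flip at k exchanges the two halves of B. *)
Lemma coordinate_half k (B : set Z) : mZ B -> flip k @^-1` B = B ->
  lam (B `&` coordinate k) = lam B / 2 /\ lam (B `\` coordinate k) = lam B / 2.
Proof.
move=> mB Bk; have P := cantor_prob_algebra.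
have mk := coordinate_measurable k.
have E : lam (B `&` coordinate k) = lam (B `\` coordinate k).
  rewrite -(@flip_measure k); last exact: measurableI.
  rewrite preimage_setI Bk; congr lam; apply/seteqP.
  by split=> f [Bf] /=; rewrite /coordinate /flip /= eqxx => /negP.
by have := alg_split P mB mk; split; lra.
Qed.

Lemma fresh_coordinates (Y : nat -> set Z) : ~ countable [set: K] ->
  (forall i, mZ (Y i)) -> exists c : nat -> K, injective c /\
    forall i n, flip (c n) @^-1` Y i = Y i.
Proof.
move=> ncK mY.
have /choice[J JP] i := measurable_flip_invariant (mY i).
have : infinite_set (~` \bigcup_i J i).
  move=> fin; apply: ncK; rewrite -(setUv (\bigcup_i J i)) -bigcup2E.
  apply: bigcup_countable => // -[_|[_|n _]] //=.
    by apply: bigcup_countable => // i _; have [] := JP i.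
  exact: finite_set_countable.
move=> /infinite_sequence[c [c_inj cJ]]; exists c; split=> // i n.
have [_ h] := JP i; apply: h => Jc; apply: (cJ n).
by exists i.
Qed.

End CantorMeasure.

(** * A uniform random variable made of fresh coordinates *)

Section Thresholds.
Variables (R : realType) (K : choiceType).
Local Notation Z := (cantor_space K).
Local Notation "'mZ'" := (@measurable _ Z).
Local Notation lam := (@cantor_measure R K).

Section Digits.
Variable c : nat -> K.
Hypothesis c_inj : injective c.

(** The first n fresh coordinates read as a binary number: divided by 2^n, this is the n-digit
    truncation of a variable uniform on [0, 1] and independent of every set invariant under the
    flips at all [c m]. *)
Fixpoint digits (n : nat) (f : K -> bool) : nat :=
  if n is m.+1 then (digits m f).*2 + f (c m) else 0.

Lemma digits_flip n m f : (n <= m)%N -> digits n (flip (c m) f) = digits n f.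
Proof.
elim: n => //= n IH nm; rewrite IH ?(ltnW nm)//; congr (_ + _)%N.
by rewrite /flip; case: eqP => // /c_inj nmE; rewrite nmE ltnn in nm.
Qed.

Definition level n j : set (K -> bool) := [set f | digits n f = j].

Lemma levelS n j : level n.+1 j = if odd j then level n j./2 `&` coordinate (c n)
  else level n j./2 `\` coordinate (c n).
Proof.
case: ifP => oj; apply/seteqP; split=> f; rewrite /level /coordinate /=.
- move=> jE; move: oj; rewrite -jE oddD odd_double => /= oj.
  by move: oj; case: (f _) => // _; rewrite addnC half_bit_double.
- by move=> [-> ->]; rewrite -[RHS]odd_double_half oj addnC.
- move=> jE; move: oj; rewrite -jE oddD odd_double => /=.
  by case: (f _) => // _; rewrite addn0 doubleK.
- by move=> [-> /negP/negbTE ->]; rewrite -[RHS]odd_double_half oj addn0.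
Qed.

Lemma level_measurable n j : mZ (level n j).
Proof.
elim: n j => [|n IH] j; last first.
  have mk := coordinate_measurable (c n).
  by rewrite levelS; case: ifP => _; [apply: measurableI|apply: measurableD].
have [->|j0] := eqVneq j 0%N.
  by rewrite (_ : level 0 0 = setT)//; apply/seteqP; split.
rewrite (_ : level 0 j = set0)//; apply/seteqP; split=> // f /= /esym/eqP.
by rewrite (negbTE j0).
Qed.

Lemma lam_level (Y : set Z) n j : mZ Y ->
  (forall m, flip (c m) @^-1` Y = Y) -> (j < 2 ^ n)%N ->
  lam (Y `&` level n j) = lam Y / 2 ^+ n.
Proof.
move=> mY Yc; elim: n j => [|n IH] j jn.
  rewrite expr0 divr1 (_ : level 0 j = setT) ?setIT//.
  by move: jn; case: j => // _; apply/seteqP; split.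
have j2 : (j./2 < 2 ^ n)%N by rewrite ltn_half_double -mul2n -expnS.
have mYL : mZ (Y `&` level n j./2) by apply: measurableI => //; apply: level_measurable.
have inv : flip (c n) @^-1` (Y `&` level n j./2) = Y `&` level n j./2.
  rewrite preimage_setI Yc; congr (_ `&` _).
  by apply/seteqP; split=> f; rewrite /level /= digits_flip.
have [hI hD] := coordinate_half R mYL inv.
rewrite levelS exprSr invfM mulrA -(IH _ j2); case: ifP => _.
  by rewrite setIA hI.
by rewrite setIDA hD.
Qed.

Definition initial n j : set (K -> bool) := [set f | (digits n f < j)%N].

Lemma initialS n j : initial n j.+1 = initial n j `|` level n j.
Proof.
have E f : (digits n f < j.+1)%N = (digits n f == j) || (digits n f < j)%N.
  by rewrite ltnS leq_eqVlt.
apply/seteqP; split=> f; rewrite /initial /level /= E.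
  by move=> /orP[/eqP|]; [right|left].
by move=> [->|->]; rewrite ?eqxx ?orbT.
Qed.

Lemma initial_measurable n j : mZ (initial n j).
Proof.
elim: j => [|j IH].
  rewrite (_ : initial n 0 = set0); first exact: measurable0.
  by apply/seteqP; split.
by rewrite initialS; apply: measurableU => //; apply: level_measurable.
Qed.

Lemma lam_initial (Y : set Z) n j : mZ Y ->
  (forall m, flip (c m) @^-1` Y = Y) -> (j <= 2 ^ n)%N ->
  lam (Y `&` initial n j) = lam Y * j%:R / 2 ^+ n.
Proof.
have P := cantor_prob_algebra R K.
move=> mY Yc; elim: j => [_|j IH jn].
  rewrite (_ : initial n 0 = set0); last by apply/seteqP; split.
  by rewrite setI0 mulr0 mul0r (alg_mu0 P).
rewrite initialS setIUr (alg_muU P).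
- rewrite IH ?(ltnW jn)// lam_level// -mulrDl -[in RHS]natr1 mulrDr mulr1; lra.
- by apply: measurableI => //; apply: initial_measurable.
- by apply: measurableI => //; apply: level_measurable.
apply/seteqP; split=> f //= [[_ fj] [_ fE]].
by move: fj; rewrite /initial /= fE ltnn.
Qed.

(** Up to a null set, the event that the uniform variable is below x, written as a union of dyadic
    events so that it grows with x without exceptional sets. *)
Definition threshold (x : R) : set (K -> bool) :=
  \bigcup_n initial n (Num.truncn (x * 2 ^+ n)).

Lemma threshold_measurable x : mZ (threshold x).
Proof. by apply: bigcupT_measurable => n; apply: initial_measurable. Qed.

Lemma threshold_mono x y : x <= y -> threshold x `<=` threshold y.
Proof.
move=> xy f [n _ fn]; exists n => //; apply: leq_trans fn _.
by apply: le_truncn; rewrite ler_wpM2r.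
Qed.

Lemma lam_threshold (Y : set Z) x : mZ Y ->
  (forall m, flip (c m) @^-1` Y = Y) -> 0 <= x <= 1 ->
  lam (Y `&` threshold x) = x * lam Y.
Proof.
have P := cantor_prob_algebra R K.
move=> mY Yc /andP[x0 x1].
have pow0 n : 0 < 2 ^+ n :> R by rewrite exprn_gt0.
have xn0 n : 0 <= x * 2 ^+ n by rewrite mulr_ge0// ltW.
have tn n := truncn_itv (xn0 n).
have t2 n : (Num.truncn (x * 2 ^+ n) <= 2 ^ n)%N.
  rewrite -(ler_nat R) natrX; have /andP[h _] := tn n; apply: le_trans h _.
  by rewrite ler_piMl// ltW.
have lamE n : lam (Y `&` initial n (Num.truncn (x * 2 ^+ n))) =
    lam Y * (Num.truncn (x * 2 ^+ n))%:R / 2 ^+ n by apply: lam_initial.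
have Y0 : 0 <= lam Y := alg_ge0 P mY.
have Y1 : lam Y <= 1 := alg_le1 P mY.
rewrite /threshold setI_bigcupr; apply: cantor_bigcup => [n|n|n|e e0].
- by apply: measurableI => //; apply: initial_measurable.
(* From [digits n f] < t follows [digits n.+1 f] < 2 t, and twice the integer part of x 2^n is at
   most that of x 2^(n+1). *)
- apply: setIS => f; rewrite /initial /= => fn.
  apply: (@leq_trans (Num.truncn (x * 2 ^+ n)).*2).
    by rewrite -(ltn_half_double) addnC half_bit_double.
  rewrite truncn_ge_nat// -muln2 natrM exprSr mulrA ler_wpM2r//.
  by have /andP[] := tn n.
- rewrite lamE -mulrA [leLHS]mulrC ler_wpM2r// ler_pdivrMr//.
  by have /andP[] := tn n.
pose n := (Num.truncn e^-1).+1; exists n.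
have e_n : (2 ^+ n)^-1 < e.
  rewrite -[ltRHS]invrK ltf_pV2 ?posrE ?invr_gt0//.
  have /andP[_ h] := truncn_itv (ltW (etrans (invr_gt0 e) e0)).
  apply: (lt_trans h); rewrite -natrX ltr_nat; exact: ltn_expl.
have /andP[_ h] := tn n.
have xt : x - (2 ^+ n)^-1 <= (Num.truncn (x * 2 ^+ n))%:R / 2 ^+ n.
  by rewrite ler_pdivlMr// mulrBl mulVf ?gt_eqF// lerBlDr natr1 ltW.
rewrite lamE -mulrA; apply: (@lt_le_trans _ _ (lam Y * (x - (2 ^+ n)^-1))).
  rewrite mulrBr [x * _]mulrC ltrD2l ltrN2; apply: le_lt_trans e_n.
  by rewrite ler_piMl// invr_ge0 ltW.
by rewrite ler_wpM2l.
Qed.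

End Digits.

Lemma thresholds_exist (Y : nat -> set Z) : ~ countable [set: K] ->
  (forall i, mZ (Y i)) -> exists D : R -> set Z,
  [/\ forall x, mZ (D x), forall x y, x <= y -> D x `<=` D y &
   forall i x, 0 <= x <= 1 -> lam (Y i `&` D x) = x * lam (Y i)].
Proof.
move=> ncK mY; have [c [c_inj Yc]] := fresh_coordinates ncK mY.
exists (threshold c); split; [exact: threshold_measurable|exact: threshold_mono|].
by move=> i x x01; apply: lam_threshold.
Qed.

End Thresholds.

(** * Completeness of the measurable sets for the measure of the symmetric difference *)

Section CantorComplete.
Variables (R : realType) (K : choiceType).
Local Notation Z := (cantor_space K).
Local Notation "'mZ'" := (@measurable _ Z).
Local Notation lam := (@cantor_measure R K).
Let P := cantor_prob_algebra R K.

Lemma cantor_bigcap_approx (B : nat -> set Z) (e : R) : (forall n, mZ (B n)) ->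
  (forall n, B n.+1 `<=` B n) -> 0 < e ->
  exists n, forall m, (n <= m)%N -> lam (B m `\` \bigcap_n B n) < e.
Proof.
move=> mB decr e0.
have mI : mZ (\bigcap_n B n) by exact: bigcapT_measurable.
have [|n|n nP] := cantor_bigcup_approx (B := fun n => ~` B n) _ _ e0.
- by move=> n; apply: measurableC.
- exact: subsetC.
have mono m : (n <= m)%N -> B m `<=` B n.
  elim: m => [|m IH]; first by rewrite leqn0 => /eqP ->.
  rewrite leq_eqVlt => /orP[/eqP ->//|]; rewrite ltnS => /IH.
  by apply: subset_trans; apply: decr.
exists n => m /mono nm; apply: (@le_lt_trans _ _ (lam (B n `\` \bigcap_n B n))).
  by apply: (alg_mono P); [exact: measurableD..|exact: setSD].
move: nP; rewrite -setC_bigcap -!setTD => nP.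
have := alg_split P measurableT (mB n); have := alg_split P measurableT mI.
rewrite !setTI (alg_muT P) => hI hn.
have := alg_split P (mB n) mI; rewrite (setIidr (_ : \bigcap_n B n `<=` B n)); last first.
  exact: bigcap_inf.
lra.
Qed.

(** Borel-Cantelli: the limit is the upper limit of a subsequence [C] whose consecutive distances
    are bounded by a geometric sequence. *)
Lemma cantor_complete (B : nat -> set Z) : (forall n, mZ (B n)) ->
  (forall e : R, 0 < e -> exists N, forall m, (N <= m)%N -> lam (B N `+` B m) <= e) ->
  exists A, mZ A /\
    forall e : R, 0 < e -> exists N, forall m, (N <= m)%N -> lam (A `+` B m) <= e.
Proof.
move=> mB cauchy.
have half0 k : 0 < 2^-1 ^+ k :> R by rewrite exprn_gt0// invr_gt0.
have mY A A' : mZ A -> mZ A' -> mZ (A `+` A') := @alg_Y _ _ _ _ _ P A A'.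
have /choice[N NP] k := cauchy _ (half0 k).
(* A running maximum, so that the chosen indices do not decrease. *)
pose M k := (\max_(j < k.+1) N j)%N.
have NM k : (N k <= M k)%N by exact: (leq_bigmax (ord_max : 'I_k.+1)).
have MM k : (M k <= M k.+1)%N by rewrite /M [leqRHS]big_ord_recr leq_maxl.
have MP k m : (M k <= m)%N -> lam (B (M k) `+` B m) <= 2 * 2^-1 ^+ k.
  move=> km; apply: (le_trans (alg_Y_le P (mB (M k)) (mB (N k)) (mB m))).
  rewrite mulr2n mulrDl mul1r; apply: lerD; first by rewrite setYC; apply: NP.
  by apply: NP; apply: leq_trans km.
pose C k := B (M k); have mC k : mZ (C k) by exact: mB.
have CC k : lam (C k.+1 `\` C k) <= 2 * 2^-1 ^+ k.
  apply: le_trans (MP k _ (MM k)); apply: (alg_mono P); [exact: measurableD|exact: mY|].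
  by move=> f; right.
pose V k n := \big[setU/set0]_(j < n) C (k + j)%N.
have mV k n : mZ (V k n) by apply: bigsetU_measurable => j _.
(* The bound is the sum of 2 * 2^-j over j from k to k + n - 1, that is, of the bounds on the
   successive increments. *)
have VC k n : lam (V k n.+1 `\` C k) <= 4 * 2^-1 ^+ k - 4 * 2^-1 ^+ (k + n).
  elim: n => [|n IH].
    by rewrite /V big_ord1 addn0 setDv (alg_mu0 P) subrr.
  apply: (@le_trans _ _ (lam (V k n.+1 `\` C k) + lam (C (k + n).+1 `\` C (k + n)%N))).
    apply: le_trans (alg_leU P _ _); [|exact: measurableD..].
    apply: (alg_mono P); [exact: measurableD|by apply: measurableU; exact: measurableD|].
    rewrite /V [X in X `\` _]big_ord_recr /= addnS => f [[Vf|Cf] nCf]; first by left.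
    have [Cnf|nCnf] := pselect (C (k + n)%N f); last by right.
    by left; split=> //; rewrite big_ord_recr; right.
  have := CC (k + n)%N; rewrite addnS exprS.
  lra.
pose U k := \bigcup_n V k n.
have mU k : mZ (U k) by exact: bigcupT_measurable.
have UC k : lam (U k `\` C k) <= 4 * 2^-1 ^+ k.
  rewrite /U setDE setI_bigcupl; apply: cantor_bigcup_le => [n|n|n].
  - by rewrite -setDE; apply: measurableD.
  - by apply: setSI; rewrite /V big_ord_recr; apply: subsetUl.
  rewrite -setDE; case: n => [|n]; last first.
    by apply: (le_trans (VC k n)); rewrite gerBl mulr_ge0// ltW.
  by rewrite /V big_ord0 set0D (alg_mu0 P) mulr_ge0// ltW.
have UE k f : U k f <-> exists j, (k <= j)%N /\ C j f.
  split=> [[n _]|[j [kj Cj]]].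
    rewrite /V -(bigcup_mkord _ (fun j => C (k + j)%N)) => -[j /= jn Cf].
    by exists (k + j)%N; rewrite leq_addr.
  exists (j - k).+1 => //; rewrite /V big_ord_recr; right.
  by rewrite /= subnKC.
pose A := \bigcap_k U k.
have decr k : U k.+1 `<=` U k.
  by move=> f /UE[j [kj Cj]]; apply/UE; exists j; split=> //; exact: ltnW.
exists A; split; first exact: bigcapT_measurable.
move=> e e0; have e20 : 0 < e / 2 by rewrite divr_gt0.
have [n nP] := cantor_bigcap_approx mU decr e20.
(* The 6 adds 4 for the distance from [U k] to [C k] and 2 for that from [C k] to a later [B m]; the
   other e / 2 covers the distance from the limit to [U k]. *)
have [k0 k0P] : exists k, 6 * 2^-1 ^+ k <= e / 2.
  exists (Num.truncn (e / 12)^-1).+1.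
  have d0 : 0 < e / 12 by rewrite divr_gt0.
  have /andP[_ h] := truncn_itv (ltW (etrans (invr_gt0 (e / 12)) d0)).
  set m := (_.+1 in X in _ * _ ^+ X).
  have : 2^-1 ^+ m <= e / 12; last by lra.
  rewrite exprVn -[leRHS]invrK lef_pV2 ?posrE ?invr_gt0// ?exprn_gt0//.
  apply: (le_trans (ltW h)); rewrite -natrX ler_nat; exact/ltnW/ltn_expl.
pose k := maxn n k0.
have kP : 6 * 2^-1 ^+ k <= e / 2.
  apply: le_trans k0P; rewrite ler_pM2l// ler_wiXn2l ?invr_ge0 ?invf_le1 ?ler1n//.
  exact: leq_maxr.
have mA : mZ A by exact: bigcapT_measurable.
exists (M k) => m km.
have h1 := alg_Y_le P mA (mC k) (mB m).
have h2 := alg_Y_le P mA (mU k) (mC k).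
have h3 := MP _ _ km.
have h4 := nP k (leq_maxl _ _).
have AU : A `<=` U k by exact: bigcap_inf.
have CU : C k `<=` U k by move=> f Cf; apply/UE; exists k.
have h5 : lam (A `+` U k) = lam (U k `\` A).
  rewrite (alg_muY P)// (_ : A `\` U k = set0) ?(alg_mu0 P) ?add0r//.
  by rewrite setD_eq0.
have h6 : lam (U k `+` C k) = lam (U k `\` C k).
  rewrite (alg_muY P)// (_ : C k `\` U k = set0) ?(alg_mu0 P) ?addr0//.
  by rewrite setD_eq0.
have := UC k.
rewrite h5 h6 in h2; rewrite -/(C k) in h3.
have -> : e = e / 2 + e / 2 by lra.
lra.
Qed.

End CantorComplete.

(** * Extension by a martingale limit *)

Section ExtendRight.
Variables (R : realType) (X : Type) (top : set X) (F : set (set X)).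
Variables (mu : set X -> R) (K : choiceType).
Local Notation Z := (cantor_space K).
Local Notation "'mZ'" := (@measurable _ Z).
Local Notation lam := (@cantor_measure R K).
Hypothesis PX : prob_algebra top F mu.
Hypothesis uncountable_K : ~ countable [set: K].
Let PY := cantor_prob_algebra R K.

Section Approximation.
Variables (p : set (set X * set (K -> bool))) (A : set X).
Hypothesis Pp :
  pair_algebra top [set: K -> bool] F (measurable : set (set Z)) mu lam p.
Hypothesis FA : F A.
Variables (U : nat -> set X) (V : nat -> set (K -> bool)) (D : R -> set (K -> bool)).
Hypothesis pUV : forall i, p (U i, V i).
Hypothesis mD : forall x, mZ (D x).
Hypothesis D_mono : forall x y, x <= y -> D x `<=` D y.
Hypothesis lamD : forall S T x, p (S, T) -> 0 <= x <= 1 ->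
  lam (T `&` D x) = x * lam T.

(* This is [0] when [mu S = 0]. *)
Definition conditional (S : set X) : R := mu (A `&` S) / mu S.

(* [step l S T] and [energy l S] refine the atom [(S, T)] along the sets of
   index in [l]: on an atom, [step] is the part of [T] below the conditional
   probability of [A], and [energy] sums up the squared conditional
   probabilities, i.e. it is the second moment of the martingale. *)
Fixpoint step (l : seq nat) (S : set X) (T : set (K -> bool)) : set (K -> bool) :=
  if l is i :: l' then
    step l' (S `&` U i) (T `&` V i) `|` step l' (S `\` U i) (T `\` V i)
  else T `&` D (conditional S).

Fixpoint energy (l : seq nat) (S : set X) : R :=
  if l is i :: l' then energy l' (S `&` U i) + energy l' (S `\` U i)
  else mu S * conditional S ^+ 2.

Let pI S T i : p (S, T) -> p (S `&` U i, T `&` V i).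
Proof. by move=> pST; apply: (pair_algebraI Pp). Qed.

Let pD S T i : p (S, T) -> p (S `\` U i, T `\` V i).
Proof. by move=> pST; have [_ h _] := Pp; apply: h. Qed.

Let pP S T : p (S, T) -> [/\ F S, mZ T & mu S = lam T].
Proof. by have [_ _ h] := Pp; apply: h. Qed.

Lemma conditionalM S : F S -> conditional S * mu S = mu (A `&` S).
Proof.
move=> FS; have FAS : F (A `&` S) by apply: (alg_I PX).
have [S0|S0] := eqVneq (mu S) 0; last by rewrite divfK.
by rewrite S0 mulr0; apply/esym/(alg_null_mono PX FAS FS) => // x [].
Qed.

Lemma conditional01 S : F S -> 0 <= conditional S <= 1.
Proof.
move=> FS; have FAS : F (A `&` S) by apply: (alg_I PX).
have S0 := alg_ge0 PX FS.
rewrite divr_ge0// ?(alg_ge0 PX)//=.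
have [S00|Sn0] := eqVneq (mu S) 0; first by rewrite /conditional S00 invr0 mulr0.
rewrite ler_pdivrMr ?mul1r; first by apply: (alg_mono PX) => // x [].
by rewrite lt_neqAle eq_sym Sn0.
Qed.

Lemma mu_split S i : F S -> F (U i) ->
  mu (A `&` S) = mu (A `&` (S `&` U i)) + mu (A `&` (S `\` U i)).
Proof.
move=> FS FU; rewrite (alg_split PX (alg_I PX FA FS) FU).
by rewrite setIA setIDA.
Qed.

Let FU i : F (U i). Proof. by have [] := pP (pUV i). Qed.
Let mV i : mZ (V i). Proof. by have [] := pP (pUV i). Qed.

Lemma step_measurable l S T : mZ T -> mZ (step l S T).
Proof.
elim: l S T => [|i l IH] S T mT /=; first exact: measurableI.
by apply: measurableU; apply: IH; [apply: measurableI|apply: measurableD].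
Qed.

Lemma step_sub l S T : step l S T `<=` T.
Proof.
elim: l S T => [|i l IH] S T /=; first by move=> f [].
by move=> f [/IH[]|/IH[]].
Qed.

Lemma step_disjoint l S S' T i :
  step l S (T `&` V i) `&` step l S' (T `\` V i) = set0.
Proof. by apply/seteqP; split=> f // [/step_sub[_ ?] /step_sub[_ []]]. Qed.

Lemma lam_step l S T : p (S, T) -> lam (step l S T) = mu (A `&` S).
Proof.
elim: l S T => [|i l IH] S T pST /=.
  have [FS mT ST] := pP pST.
  by rewrite (lamD pST (conditional01 FS)) -ST conditionalM.
have [FS mT ST] := pP pST.
rewrite (alg_muU PY) ?step_disjoint//.
- by rewrite (mu_split FS (FU i)) !IH//; [apply: pD|apply: pI].
- by apply: step_measurable; apply: measurableI.
- by apply: step_measurable; apply: measurableD.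
Qed.

Lemma lam_step_mem l S T i : p (S, T) -> i \in l ->
  lam (step l S T `&` V i) = mu (A `&` S `&` U i).
Proof.
elim: l S T => //= j l IH S T pST; have [FS mT ST] := pP pST.
rewrite in_cons => /orP[/eqP ->|il].
  rewrite setIUl (setIidl (_ : step l _ _ `<=` V j)); last by move=> f /step_sub[].
  rewrite (_ : step l _ _ `&` V j = set0) ?setU0; last first.
    by apply/seteqP; split=> f // [/step_sub[_ ?]].
  by rewrite (lam_step _ (pI _ pST)) setIA.
rewrite setIUl (alg_muU PY).
- rewrite !IH//; [|exact: pD|exact: pI].
  rewrite (alg_split PX (alg_I PX (alg_I PX FA FS) (FU i)) (FU j)).
  by congr (mu _ + mu _); apply/seteqP; split=> x /=; tauto.
- by apply: measurableI => //; apply: step_measurable; apply: measurableI.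
- by apply: measurableI => //; apply: step_measurable; apply: measurableD.
by rewrite setIACA step_disjoint set0I.
Qed.

Lemma threshold_dist S T x y : p (S, T) -> 0 <= x <= 1 -> 0 <= y <= 1 ->
  lam ((T `&` D x) `+` (T `&` D y)) = `|x - y| * mu S.
Proof.
move=> pST; have [FS mT ST] := pP pST.
have sym x' y' : x' <= y' -> 0 <= x' <= 1 -> 0 <= y' <= 1 ->
    lam ((T `&` D x') `+` (T `&` D y')) = `|x' - y'| * mu S.
  move=> xy x01 y01; have sub : T `&` D x' `<=` T `&` D y' by apply: setIS; exact: D_mono.
  have mx : mZ (T `&` D x') by apply: measurableI.
  have my : mZ (T `&` D y') by apply: measurableI.
  rewrite (alg_muY PY)// (_ : (T `&` D x') `\` _ = set0); last by rewrite setD_eq0.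
  rewrite (alg_mu0 PY) add0r ler0_norm ?subr_le0//.
  have := alg_split PY my mx; rewrite (setIidr sub) (lamD pST y01) (lamD pST x01) ST.
  lra.
have [xy|/ltW yx] := leP x y; first exact: sym.
by move=> x01 y01; rewrite setYC sym// distrC.
Qed.

Lemma step_cons_dist l S T i B : p (S, T) -> mZ B ->
  lam ((T `&` B) `+` step (i :: l) S T) <=
    lam (((T `&` V i) `&` B) `+` step l (S `&` U i) (T `&` V i)) +
    lam (((T `\` V i) `&` B) `+` step l (S `\` U i) (T `\` V i)).
Proof.
move=> pST mB; have [FS mT ST] := pP pST.
have m1 : mZ (((T `&` V i) `&` B) `+` step l (S `&` U i) (T `&` V i)).
  apply: (alg_Y PY); last by apply: step_measurable; apply: measurableI.
  by apply: measurableI => //; apply: measurableI.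
have m2 : mZ (((T `\` V i) `&` B) `+` step l (S `\` U i) (T `\` V i)).
  apply: (alg_Y PY); last by apply: step_measurable; apply: measurableD.
  by apply: measurableI => //; apply: measurableD.
apply: le_trans (alg_leU PY m1 m2); apply: (alg_mono PY).
- by apply: (alg_Y PY); [apply: measurableI|apply: step_measurable].
- exact: measurableU.
move=> f; rewrite /setY /=; have [Vf|nVf] := pselect (V i f); tauto.
Qed.

(* [|d| <= e + d^2 / e], integrated *)
Lemma step_threshold l S T x e : p (S, T) -> 0 <= x <= 1 -> 0 < e ->
  lam ((T `&` D x) `+` step l S T) <=
    e * mu S + (energy l S - 2 * x * mu (A `&` S) + x ^+ 2 * mu S) / e.
Proof.
move=> + x01 e0; elim: l S T => [|i l IH] S T pST; have [FS mT ST] := pP pST.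
  rewrite /= (threshold_dist pST x01 (conditional01 FS)) -(conditionalM FS).
  set c := conditional S.
  have -> : mu S * c ^+ 2 - 2 * x * (c * mu S) + x ^+ 2 * mu S = (x - c) ^+ 2 * mu S.
    ring.
  rewrite mulrAC -mulrDl ler_wpM2r// ?(alg_ge0 PX)//.
  rewrite -(ler_pM2r e0) mulrDl divfK ?gt_eqF// -(real_normK (num_real (x - c))).
  have := sqr_ge0 (`|x - c| - e); have := normr_ge0 (x - c).
  nra.
apply: (le_trans (step_cons_dist _ _ pST (mD x))).
apply: (le_trans (lerD (IH _ _ (pI i pST)) (IH _ _ (pD i pST)))).
rewrite /= (mu_split FS (FU i)) [in leRHS](alg_split PX FS (FU i)).
by rewrite le_eqVlt; apply/orP; left; apply/eqP; ring.
Qed.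

(** An expanded sum of squares: over the atoms into which l cuts S, the measure times the squared
    deviation of the conditional probability from x. *)
Lemma energy_dev_ge0 l S x : F S ->
  0 <= energy l S - 2 * x * mu (A `&` S) + x ^+ 2 * mu S.
Proof.
elim: l S => [|i l IH] S FS /=.
  rewrite -(conditionalM FS); set c := conditional S.
  have -> : mu S * c ^+ 2 - 2 * x * (c * mu S) + x ^+ 2 * mu S = (x - c) ^+ 2 * mu S.
    ring.
  by rewrite mulr_ge0 ?sqr_ge0 ?(alg_ge0 PX).
rewrite (mu_split FS (FU i)) (alg_split PX FS (FU i)).
have := IH _ (alg_I PX FS (FU i)); have := IH _ (alg_D PX FS (FU i)).
lra.
Qed.

(** Orthogonality of martingale increments: refining an atom raises the energy by the squared
    deviations from the old conditional probability, which is [energy_dev_ge0] with x chosen as that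
    probability. *)
Lemma energy_cat l l' S : F S -> energy l S <= energy (l ++ l') S.
Proof.
elim: l S => [|i l IH] S FS /=; last first.
  by apply: lerD; apply: IH; [apply: (alg_I PX)|apply: (alg_D PX)].
have := energy_dev_ge0 l' (conditional S) FS; rewrite -(conditionalM FS).
move=> h; rewrite -subr_ge0; apply: le_trans h _.
by rewrite le_eqVlt; apply/orP; left; apply/eqP; ring.
Qed.

Lemma energy_le l S : F S -> energy l S <= mu S.
Proof.
elim: l S => [|i l IH] S FS /=.
  have /andP[c0 c1] := conditional01 FS.
  by rewrite ler_piMr ?(alg_ge0 PX)// exprn_ile1.
rewrite (alg_split PX FS (FU i)).
by apply: lerD; apply: IH; [apply: (alg_I PX)|apply: (alg_D PX)].
Qed.

(** [step_threshold] is applied on each atom of l, with x its conditional probability. The distance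
    between two steps is thus controlled by the gain in energy, which tends to 0 because the energy
    is monotone and bounded. *)
Lemma step_cat l l' S T e : p (S, T) -> 0 < e ->
  lam (step l S T `+` step (l ++ l') S T) <=
    e * mu S + (energy (l ++ l') S - energy l S) / e.
Proof.
move=> + e0; elim: l S T => [|i l IH] S T pST; have [FS mT ST] := pP pST.
  apply: (le_trans (step_threshold l' pST (conditional01 FS) e0)).
  rewrite /= -(conditionalM FS) le_eqVlt; apply/orP; left; apply/eqP; ring.
have m1 l1 : mZ (step l1 (S `&` U i) (T `&` V i)).
  by apply: step_measurable; apply: measurableI.
have m2 l1 : mZ (step l1 (S `\` U i) (T `\` V i)).
  by apply: step_measurable; apply: measurableD.
apply: (@le_trans _ _ (
    lam (step l (S `&` U i) (T `&` V i) `+` step (l ++ l') (S `&` U i) (T `&` V i)) +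
    lam (step l (S `\` U i) (T `\` V i) `+` step (l ++ l') (S `\` U i) (T `\` V i)))).
  apply: le_trans (alg_leU PY _ _); [|exact: (alg_Y PY)..].
  apply: (alg_mono PY).
  - by apply: (alg_Y PY); apply: measurableU.
  - by apply: measurableU; apply: (alg_Y PY).
  by move=> f; rewrite /setY /=; tauto.
apply: (le_trans (lerD (IH _ _ (pI i pST)) (IH _ _ (pD i pST)))).
rewrite /= [in leRHS](alg_split PX FS (FU i)).
by rewrite le_eqVlt; apply/orP; left; apply/eqP; ring.
Qed.

Lemma martingale_limit : exists B, mZ B /\
  forall i, mu (A `&` U i) = lam (B `&` V i).
Proof.
have [pT _ _] := Pp.
pose B n := step (iota 0 n) top setT.
have mB n : mZ (B n) by apply: step_measurable.
pose en n := energy (iota 0 n) top.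
have FT := alg_T PX.
have iotaE n m : (n <= m)%N -> iota 0 m = iota 0 n ++ iota n (m - n).
  by move=> nm; rewrite -[in LHS](subnKC nm) iotaD add0n.
have en_mono n m : (n <= m)%N -> en n <= en m.
  by move=> nm; rewrite /en (iotaE _ _ nm) energy_cat.
have [|L [mL LP]] := @cantor_complete R K B mB.
  (* With the remaining gain in energy below d^2, the bound of [step_cat] at d is at most d + d^2 /
     d = e. *)
  move=> e e0; pose d := e / 2; have d0 : 0 < d by rewrite divr_gt0.
  have [N NP] : exists N, forall m, en m < en N + d ^+ 2.
    pose E := [set en n | n in setT].
    have E0 : has_sup E.
      split; first by exists (en 0%N), 0%N.
      by exists (mu top) => _ [n _ <-]; apply: energy_le.
    have d20 : 0 < d ^+ 2 by rewrite exprn_gt0.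
    have [_ [N _ <-] NE] := sup_adherent d20 E0; exists N => m.
    rewrite -ltrBlDr; apply: le_lt_trans NE; rewrite lerD2r.
    by apply: ub_le_sup; [case: E0|exists m].
  exists N => m Nm; rewrite /B (iotaE _ _ Nm).
  apply: (le_trans (step_cat _ _ pT d0)); rewrite (alg_muT PX) mulr1.
  rewrite -iotaE// -/(en m) -/(en N).
  have : (en m - en N) / d <= d.
    by rewrite ler_pdivrMr// -expr2 lerBlDl ltW// addrC.
  rewrite /d; lra.
exists L; split=> // i; apply/eqP; rewrite -subr_eq0 -normr_le0.
apply/ler_addgt0Pr => e e0; rewrite add0r; have [N NP] := LP e e0.
(* From step i + 1 on, the set [V i] is among those refined by, so its intersection with [B m]
   already has the prescribed measure and only the distance to the limit remains. *)
pose m := maxn N i.+1.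
have <- : lam (B m `&` V i) = mu (A `&` U i).
  rewrite (lam_step_mem pT) ?(setIidl (alg_top PX FA))//.
  by rewrite mem_iota add0n; exact: leq_maxr.
apply: le_trans (NP m (leq_maxl _ _)).
apply: (le_trans (alg_dist PY _ _)); [exact: measurableI..|].
apply: (alg_mono PY); [by apply: (alg_Y PY); apply: measurableI|exact: (alg_Y PY)|].
by move=> f; rewrite /setY /=; tauto.
Qed.

End Approximation.

Lemma extend_right p A :
  pair_algebra top [set: K -> bool] F (measurable : set (set Z)) mu lam p ->
  countable p -> F A ->
  exists B, mZ B /\ forall U V, p (U, V) -> mu (A `&` U) = lam (B `&` V).
Proof.
move=> Pp cp FA; have [pT pD pP] := Pp.
have [s [ps s_surj]] := countable_enumeration pT cp.
have pUV i : p ((s i).1, (s i).2) by rewrite -surjective_pairing.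
have mV i : mZ (s i).2 by have [] := pP _ _ (pUV i).
have [D [mD D_mono lamD]] := thresholds_exist R uncountable_K mV.
have [|B [mB BP]] := martingale_limit Pp FA pUV mD D_mono.
  by move=> S T x /s_surj[i si]; have := lamD i x; rewrite si.
by exists B; split=> // U V /s_surj[i si]; have := BP i; rewrite si.
Qed.

End ExtendRight.

(** * Recursion along omega_1 and the isomorphism *)

Definition omega1_lt (y x : omega1) : Prop := omega1_le y x /\ y <> x.

Lemma omega1_lt_wf : well_founded omega1_lt.
Proof.
move=> x; apply: contrapT => nAx; have [wo _ _] := omega1P.
have [|z [[]]] := wo (mem [set x : omega1 | ~ Acc omega1_lt x]).
  by exists x; rewrite inE.
rewrite inE /= => nAz zmin _; apply: nAz; constructor => y [yz ynz].
apply: contrapT => nAy; apply: ynz.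
(* Antisymmetry is drawn from the uniqueness of minima: y and z are both minimal in the pair they
   form. *)
have [wo_zy] : exists! u, minimum_of omega1_le (mem [set y; z]) u.
  by apply: wo; exists y; rewrite inE; left.
move=> [_ uniq_u].
have rxx u : omega1_le u u.
  have [v [[+ vP] _]] := wo (mem [set u]) (ex_intro _ u (mem_set erefl)).
  by rewrite inE => /= vu; have := vP u; rewrite vu inE => /(_ erefl).
have zy : omega1_le z y by apply: zmin; rewrite inE.
have <- : wo_zy = y.
  apply: uniq_u; split; first by rewrite inE; left.
  by move=> u; rewrite inE => -[->|->]; [exact: rxx|exact: yz].
apply: uniq_u; split; first by rewrite inE; right.
by move=> u; rewrite inE => -[->|->]; [exact: zy|exact: rxx].
Qed.

Lemma omega1_le_total x y : omega1_lt x y \/ x = y \/ omega1_lt y x.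
Proof.
have [wo _ _] := omega1P.
have [|z [[+ zP] _]] := wo (mem [set x; y]); first by exists x; rewrite inE; left.
have [->|xy] := pselect (x = y); first by right; left.
rewrite inE => -[zE|zE]; [left|right; right]; rewrite -?zE.
  split; last by rewrite zE.
  by apply: zP; rewrite inE; right.
split; last by rewrite zE => yx; apply: xy.
by apply: zP; rewrite inE; left.
Qed.

(** The step sees the earlier values as a set, without their indices; this is all that taking unions
    or avoiding earlier values requires. *)
Lemma omega1_rec (T : Type) (step : omega1 -> set T -> T) :
  exists f, forall x, f x = step x (f @` [set y | omega1_lt y x]).
Proof.
pose F x (rec : forall y, omega1_lt y x -> T) :=
  step x [set t | exists y (yx : omega1_lt y x), rec y yx = t].
exists (Fix omega1_lt_wf (fun=> T) F) => x; rewrite Fix_eq.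
  rewrite /F; congr step; apply/seteqP; split=> t.
    by move=> [y [yx <-]]; exists y.
  by move=> [y yx <-]; exists y, yx.
move=> y g h gh; rewrite /F; congr step; apply/seteqP.
by split=> t [z [zy <-]]; exists z, zy.
Qed.

Lemma omega1_lt_countable x : countable [set y | omega1_lt y x].
Proof.
have [_ _ h] := omega1P; apply: sub_countable (h x).
by apply: subset_card_le => y [].
Qed.

(** Otherwise omega_1 would be a countable union of countable initial segments. *)
Lemma omega1_sequence_bounded (a : nat -> omega1) :
  exists x, forall n, omega1_lt (a n) x \/ a n = x.
Proof.
apply: contrapT => /forallNP nb; have [_ unc init] := omega1P; apply: unc.
apply: (@sub_countable _ _ _ (\bigcup_n [set y | omega1_le y (a n)])).
  apply: subset_card_le => x _.
  have /existsNP[n /not_orP[nax anx]] := nb x; exists n => //=.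
  by have [[]//|[xan|//]] := omega1_le_total x (a n); case: anx.
by apply: bigcup_countable.
Qed.

(** Recursion along omega_1 picks a member of G outside the countable set of earlier values. *)
Lemma uncountable_omega1_le (T : Type) (G : set T) :
  ~ countable G -> [set: omega1] #<= G.
Proof.
move=> unc.
have [t0 _] : exists t0 : T, True.
  apply: contrapT => nT; apply: unc; rewrite (_ : G = set0)//.
  by apply/seteqP; split=> t // _; apply: nT; exists t.
have /choice[g gP] (V : set T) : exists t, countable V -> G t /\ ~ V t.
  have [cV|ncV] := pselect (countable V); last by exists t0.
  suff [t tP] : exists t, G t /\ ~ V t by exists t.
  apply: contrapT => /forallNP GV; apply: unc; apply: sub_countable cV.
  apply: subset_card_le => t Gt; apply: contrapT => nVt; exact: (GV t).
have [f fE] := omega1_rec (fun _ V => g V).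
have fP x : G (f x) /\ ~ (f @` [set y | omega1_lt y x]) (f x).
  have := gP _ (sub_countable (card_image_le f _) (omega1_lt_countable x)).
  by rewrite -(fE x).
have f_inj : injective f.
  move=> x y fxy; have [xy|[//|yx]] := omega1_le_total x y.
    by have [_ []] := fP y; exists x.
  by have [_ []] := fP x; exists y.
have fG : f @` setT #<= G.
  by apply: subset_card_le => _ [x _ <-]; have [] := fP x.
apply: card_le_trans fG.
have /card_eqPle[] // : f @` setT #= [set: omega1].
by apply: inj_card_eq => x y _ _; apply: f_inj.
Qed.

(** Q x is the task of stage x. Only unions of countable chains need to preserve P, since every
    point of omega_1 has countably many predecessors. *)
Lemma omega1_chain (T : Type) (P : set T -> Prop) (Q : omega1 -> set T -> Prop)
    (p0 : set T) : P p0 ->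
  (forall x p, P p -> exists p', [/\ P p', p `<=` p' & Q x p']) ->
  (forall C : set (set T), countable C -> C !=set0 -> (forall p, C p -> P p) ->
    (forall p p', C p -> C p' -> p `<=` p' \/ p' `<=` p) ->
    P (\bigcup_(p in C) p)) ->
  exists f, forall x, [/\ P (f x), Q x (f x) &
    forall y, omega1_lt y x -> f y `<=` f x].
Proof.
move=> Pp0 ext union.
have /choice[e eP] : forall xp : omega1 * set T, exists p', P xp.2 ->
    [/\ P p', xp.2 `<=` p' & Q xp.1 p'].
  move=> [x p]; have [Pp|nPp] := pselect (P p); last by exists p.
  by have [p' p'P] := ext x p Pp; exists p'.
(* Including p0 keeps the chain nonempty at the least point. *)
have [f fE] := omega1_rec (fun x V => e (x, \bigcup_(p in [set p0] `|` V) p)).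
suff inv x : [/\ P (f x), Q x (f x), p0 `<=` f x &
    forall y, omega1_lt y x -> f y `<=` f x].
  by exists f => x; have [] := inv x.
elim: (omega1_lt_wf x) => {}x _ IH.
set V := f @` [set y | omega1_lt y x] in fE.
have := eP (x, \bigcup_(p in [set p0] `|` (f @` [set y | omega1_lt y x])) p).
rewrite -fE => -[|Pf sub Qf].
  apply: union.
  - rewrite -bigcup2E; apply: bigcup_countable => // -[_|[_|n _]] //=.
    exact: sub_countable (card_image_le _ _) (omega1_lt_countable x).
  - by exists p0; left.
  - by move=> _ [->//|[y /IH[? _ _ _] <-]].
  move=> _ _ [->|[y yx <-]] [->|[z zx <-]].
  - by left.
  - by left; have [] := IH z zx.
  - by right; have [] := IH y yx.
  have [yz|[->|zy]] := omega1_le_total y z; first by left; have [_ _ _] := IH z zx; apply.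
    by left.
  by right; have [_ _ _] := IH y yx; apply.
split=> //; first by move=> t p0t; apply: sub; exists p0 => //; left.
by move=> y yx t fyt; apply: sub; exists (f y) => //; right; exists y.
Qed.

Lemma pair_algebra_bigcup (R : realType) (X Y : Type) (topX : set X)
    (topY : set Y) F G (mu : set X -> R) (lam : set Y -> R)
    (C : set (set (set X * set Y))) : C !=set0 ->
  (forall p, C p -> pair_algebra topX topY F G mu lam p) ->
  (forall p p', C p -> C p' -> p `<=` p' \/ p' `<=` p) ->
  pair_algebra topX topY F G mu lam (\bigcup_(p in C) p).
Proof.
move=> [p0 Cp0] CP chain; split.
- by exists p0 => //; have [] := CP _ Cp0.
- move=> A B A' B' [p Cp pAB] [p' Cp' pAB'].
  have [pp'|p'p] := chain _ _ Cp Cp'.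
    by exists p' => //; have [_ h _] := CP _ Cp'; apply: h => //; apply: pp'.
  by exists p => //; have [_ h _] := CP _ Cp; apply: h => //; apply: p'p.
by move=> A B [p Cp pAB]; have [_ _ h] := CP _ Cp; apply: h.
Qed.

(** The approximable sets are closed under complements, which leave symmetric differences unchanged,
    and under countable unions, which are close in measure to finite ones. Cylinders belong to D
    itself. *)
Lemma cantor_dense (R : realType) (K : choiceType) (D : set (set (K -> bool))) :
  (forall B, D B -> measurable (B : set (cantor_space K))) ->
  D setT -> (forall B B', D B -> D B' -> D (B `\` B')) ->
  (forall k, D (coordinate k)) ->
  forall B : set (cantor_space K), measurable B ->
  forall e : R, 0 < e -> exists B', D B' /\ cantor_measure R (B `+` B') <= e.
Proof.
move=> mD DT Ddiff Dk B0 mB0.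
have P := cantor_prob_algebra R K.
have DC B : D B -> D (~` B) by move=> DB; rewrite -setTD; apply: Ddiff.
have DI B B' : D B -> D B' -> D (B `&` B').
  by move=> DB DB'; rewrite -setDD; apply: (Ddiff _ _ DB); apply: Ddiff.
have DU B B' : D B -> D B' -> D (B `|` B').
  by move=> DB DB'; rewrite -[B `|` B']setCK setCU; apply/DC/DI; apply: DC.
pose good (B : set (cantor_space K)) := forall e : R, 0 < e ->
  exists B', D B' /\ cantor_measure R (B `+` B') <= e.
(* Measurability is part of the induction statement because [cantor_ind] does not supply it for the
   sets it passes through. *)
suff [] : measurable (B0 : set (cantor_space K)) /\ good B0 by [].
move: B0 mB0; apply: (@cantor_ind _
  [set B | measurable (B : set (cantor_space K)) /\ good B]).
- move=> t; split=> [|e e0]; first exact: cylinder_measurable.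
  exists (cylinder t); split; last by rewrite setYK (alg_mu0 P) ltW.
  rewrite (_ : cylinder t =
    [set f | all (fun k => f k == odflt false t.[? k]%fmap) (domf t)]); last first.
    by apply/seteqP; split=> f /cylinderE.
  elim: (enum_fset (domf t)) => [|k s IH] /=.
    by rewrite (_ : mkset _ = setT)//; apply/seteqP; split.
  rewrite (_ : mkset _ = [set f : K -> bool | f k == odflt false t.[? k]%fmap] `&`
    [set f | all (fun k => f k == odflt false t.[? k]%fmap) s]); last first.
    by apply/seteqP; split=> f /=; [move/andP|move=> /andP].
  apply: DI => //; case: (odflt _ _).
    rewrite (_ : mkset _ = coordinate k)//.
    by apply/seteqP; split=> f; rewrite /coordinate /= eqb_id.
  rewrite (_ : mkset _ = ~` coordinate k); first exact: DC.
  by apply/seteqP; split=> f; rewrite /coordinate /= eqbF_neg => /negP.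
- move=> B [mB gB]; split=> [|e /gB[B' [DB' BB']]]; first exact: measurableC.
  exists (~` B'); split; first exact: DC.
  rewrite (_ : _ `+` _ = B `+` B')//; apply/seteqP.
  split=> f; rewrite /setY /=;
  by have [] := pselect (B f); have [] := pselect (B' f); tauto.
move=> B gB; have mB n : measurable (B n : set (cantor_space K)) by have [] := gB n.
split; first exact: bigcupT_measurable.
pose V n := \big[setU/set0]_(j < n) B j.
have mV n : measurable (V n : set (cantor_space K)) by apply: bigsetU_measurable => j _.
have gV n : good (V n).
  elim: n => [|n IH] e e0.
    exists set0; split; first by rewrite -setCT; apply: DC.
    by rewrite /V big_ord0 setYK (alg_mu0 P) ltW.
  have e20 : 0 < e / 2 by rewrite divr_gt0.
  have [B1 [DB1 h1]] := IH _ e20; have [_ /(_ _ e20)[B2 [DB2 h2]]] := gB n.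
  exists (B1 `|` B2); split; first exact: DU.
  rewrite [e]splitr; apply: le_trans (lerD h1 h2).
  have m1 := mD _ DB1; have m2 := mD _ DB2.
  apply: le_trans (alg_leU P (alg_Y P (mV n) m1) (alg_Y P (mB n) m2)).
  rewrite /V big_ord_recr /=; apply: (alg_mono P).
  - by apply: (alg_Y P); apply: measurableU => //; apply: mV.
  - by apply: measurableU; apply: (alg_Y P) => //; apply: mV.
  by move=> f; rewrite /setY /=; tauto.
have UV : \bigcup_n B n = \bigcup_n V n.
  apply/seteqP; split=> [f [n _ Bf]|f [n _]].
    by exists n.+1 => //; rewrite /V big_ord_recr; right.
  by rewrite /V -bigcup_mkord => -[j _ Bf]; exists j.
move=> e e0; have e20 : 0 < e / 2 by rewrite divr_gt0.
have [|n /ltW nP] := cantor_bigcup_approx mV _ e20.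
  by move=> n; rewrite /V big_ord_recr; apply: subsetUl.
have [B' [DB' h]] := gV n _ e20; exists B'; split=> //.
have mU : measurable (\bigcup_n B n : set (cantor_space K)) by exact: bigcupT_measurable.
apply: (le_trans (alg_Y_le P mU (mV n) (mD _ DB'))).
rewrite [e]splitr; apply: lerD => //.
have VU : V n `<=` \bigcup_n B n by rewrite UV; apply: bigcup_sup.
rewrite (alg_muY P)// (_ : V n `\` _ = set0); last by rewrite setD_eq0.
rewrite (alg_mu0 P) addr0; have := alg_split P mU (mV n).
by rewrite (setIidr VU) [in X in X = _ -> _]UV; lra.
Qed.

Lemma surjection_exists (T U : Type) : [set: T] #<= [set: U] ->
  inhabited T -> exists g : U -> T, forall t, exists u, g u = t.
Proof.
elim/Ppointed: T => T; first by move=> _ [/no].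
by move=> /pcard_surjP[g g_surj] _; exists g => t; have [u _ <-] := g_surj t I; exists u.
Qed.

(** * The back-and-forth and its limit *)

Section Isomorphism.
Variables (R : realType) (M : arith_structure) (W : M).
Hypothesis MTA : model_of_true_arithmetic M.
Hypothesis Wns : nonstandard W.
Hypothesis Msat : omega1_saturated M.
Hypothesis cardM : [set: M] #<= [set: omega1].

Local Notation F := (coded_subsets W).
Local Notation mu := (internal_measure R W).
Local Notation Z := (cantor_space omega1).
Local Notation "'mZ'" := (@measurable _ Z).
Local Notation lam := (@cantor_measure R omega1).
Local Notation pair_alg :=
  (pair_algebra (below W) [set: omega1 -> bool] F mZ mu lam).

Let uncountable_omega1 : ~ countable [set: omega1].
Proof. by have [] := omega1P. Qed.

Lemma coded_prob_algebra : prob_algebra (below W) F mu.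
Proof.
split.
- exact: codedT.
- exact: coded_subset.
- exact: codedD.
- by split; [exact: mu_ge0|exact: muT].
- exact: muU.
Qed.

Let PX := coded_prob_algebra.
Let PY := cantor_prob_algebra R omega1.

Lemma extend_both (A : set M) (k : omega1) p : pair_alg p -> countable p -> F A ->
  exists p', [/\ pair_alg p', countable p', p `<=` p',
    exists B, p' (A, B) & exists A', p' (A', coordinate k)].
Proof.
move=> Pp cp FA.
have [B [mB AB]] := extend_right PX uncountable_omega1 Pp cp FA.
have P1 := adjoin_algebra PX PY Pp FA mB AB.
have c1 := adjoin_countable A B cp.
have mk := coordinate_measurable k.
have [A' [FA' AB']] := extend_left PX PY P1 c1 mk (@mu_dense _ _ _ MTA Wns)
  (model_saturation MTA Wns Msat).
exists (adjoin A' (coordinate k) (adjoin A B p)); split.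
- exact: adjoin_algebra.
- exact: adjoin_countable.
- exact: (subset_trans (@sub_adjoin _ _ A B p) (@sub_adjoin _ _ _ _ _)).
- by exists B; apply: sub_adjoin; exact: (adjoin_mem PX PY Pp).
- by exists A'; exact: (adjoin_mem PX PY P1).
Qed.

Lemma omega1_chain_of_algebras : exists f : omega1 -> set (set M * set (omega1 -> bool)),
  [/\ forall x, pair_alg (f x) /\ countable (f x),
    forall x y, omega1_lt y x -> f y `<=` f x,
    forall A, F A -> exists x B, f x (A, B) &
    forall k, exists x A, f x (A, coordinate k)].
Proof.
(* Each index has two tasks: stage x treats the set with code [a x] and the coordinate x. *)
have [a aS] := surjection_exists cardM (inhabits W).
pose C x := coded_set W MTA (a x).
have FC x : F (C x) by apply/(coded_subsetsP W MTA); exists (a x).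
pose P p := pair_alg p /\ countable p.
pose Q (x : omega1) (p : set (set M * set (omega1 -> bool))) :=
  (exists B, p (C x, B)) /\ (exists A, p (A, coordinate x)).
have [| | |f fP] := @omega1_chain _ P Q [set u | u = (below W, setT) \/ u = (set0, set0)].
- split; first exact: pair_algebra_trivial.
  rewrite (_ : mkset _ = [set (below W, setT)] `|` [set (set0, set0)])//.
  by apply: finite_set_countable; rewrite finite_setU; split; exact: finite_set1.
- move=> x p [Pp cp]; have [p' [Pp' cp' pp' hA hk]] := extend_both x Pp cp (FC x).
  by exists p'; split.
- move=> D cD D0 DP chain; split.
    by apply: pair_algebra_bigcup => // p /DP[].
  by apply: bigcup_countable => // p /DP[].
exists f; split.
- by move=> x; have [] := fP x.
- by move=> x y yx; have [_ _ h] := fP x; apply: h.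
- move=> A /(coded_subsetsP W MTA)[c ->]; have [x <-] := aS c.
  by have [_ [[B fB] _] _] := fP x; exists x, B.
- by move=> k; have [_ [_ [A fA]] _] := fP k; exists k, A.
Qed.

Lemma model_algebra_isomorphic :
  measure_algebra_isomorphic (model_algebra R W) (cantor_algebra R omega1).
Proof.
have [f [fP f_mono totA totk]] := omega1_chain_of_algebras.
pose p := \bigcup_(q in range f) q.
have Pp : pair_alg p.
  apply: pair_algebra_bigcup.
  - have [x _] : exists x : omega1, True.
      apply: contrapT => nx; apply: uncountable_omega1.
      rewrite (_ : setT = set0)//; apply/seteqP; split=> // x _.
      by apply: nx; exists x.
    by exists (f x), x.
  - by move=> _ [x _ <-]; have [] := fP x.
  move=> _ _ [x _ <-] [y _ <-].
  have [/f_mono|[->|/f_mono]] := omega1_le_total x y; by [left|right].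
have fp x u : f x u -> p u by move=> fxu; exists (f x) => //; exists x.
have totX A : F A -> exists B, p (A, B).
  by move=> /totA[x [B fx]]; exists B; apply: fp fx.
have [pT pD pP] := Pp.
apply: (quotient_isomorphic PX PY Pp totX) => B mB.
have dense e : 0 < e -> exists u, p u /\ lam (B `+` u.2) <= e.
  move=> e0.
  have [|||k|B' [[A' pAB'] h]] :=
      @cantor_dense R omega1 [set B' | exists A', p (A', B')] _ _ _ _ B mB e e0.
  - by move=> B' [A' /pP[]].
  - by exists (below W).
  - by move=> B1 B2 [A1 p1] [A2 p2]; exists (A1 `\` A2); apply: pD.
  - by have [x [A fx]] := totk k; exists A; apply: fp fx.
  by exists (A', B').
have /choice[u uP] n := dense (n.+1%:R^-1) (etrans (invr_gt0 _) (ltr0Sn _ n)).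
have /choice[x xP] n : exists x, f x (u n).
  by have [[_ [x _ <-] fxu] _] := uP n; exists x.
(* By uncountable cofinality a single stage, still countable, contains the whole approximating
   sequence. *)
have [y yP] := omega1_sequence_bounded x.
have fyu n : f y (u n).
  by have [/f_mono|<-] := yP n; [apply|exact: xP]; exact: xP.
have [Pf cf] := fP y.
have [A [FA AB]] := extend_left PX PY Pf cf mB (@mu_dense _ _ _ MTA Wns)
  (model_saturation MTA Wns Msat).
(* This A has a partner B' in p. Both B and B' have the measure of A, and their intersections with
   [(u n).2] have the measure of A intersected with [(u n).1]. They are therefore equally far from
   [(u n).2], hence at distance at most 2 / (n + 1) from each other. *)
have [B' pAB'] := totX A FA; exists A, B'; split=> //.
have [_ mB' _] := pP _ _ pAB'.
apply/eqP; rewrite eq_le (alg_ge0 PY) ?andbT; last exact: (alg_Y PY).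
apply/ler_addgt0Pr => e e0; rewrite add0r.
pose n := (Num.truncn (e / 2)^-1); have [pu Bu] := uP n.
have pun : p ((u n).1, (u n).2) by rewrite -surjective_pairing.
have [Fu mu2 muu] := pP _ _ pun.
have fyun : f y ((u n).1, (u n).2) by rewrite -surjective_pairing.
have nE : n.+1%:R^-1 <= e / 2.
  have d0 : 0 < e / 2 by rewrite divr_gt0.
  rewrite -[leRHS]invrK lef_pV2 ?posrE ?invr_gt0// ?ltr0n//.
  by have /andP[_ /ltW] := truncn_itv (ltW (etrans (invr_gt0 _) d0)).
apply: (le_trans (alg_Y_le PY mB mu2 mB')).
rewrite [e]splitr; apply: lerD; first exact: le_trans nE.
apply: le_trans nE; apply: le_trans Bu; rewrite [X in lam X <= _]setYC.
rewrite (alg_muY PY)// (alg_muY PY)//.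
have E1 := alg_split PY mB mu2; have E2 := alg_split PY mu2 mB.
have E3 := alg_split PX FA Fu; have E4 := alg_split PX Fu FA.
have pI := pair_algebraI Pp pAB' pun.
have F1 : mu (A `&` (u n).1) = lam (B `&` (u n).2) by apply: AB.
have F2 : mu A = lam B.
  have [fT _ _] := Pf; have := AB _ _ fT.
  by rewrite setIT (setIidl (alg_top PX FA)).
have [_ _ F3] := pP _ _ pI; have [_ _ F4] := pP _ _ pAB'.
have E5 := alg_split PY mB' mu2; have E6 := alg_split PY mu2 mB'.
rewrite (setIC _ B) in E2; rewrite (setIC _ B') in E6.
lra.
Qed.

End Isomorphism.

(** * The Maharam type *)

Section Quotients.
Variables (R : realType) (X : Type) (top : set X) (F : set (set X)).
Variable mu : set X -> R.
Hypothesis P : prob_algebra top F mu.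
Local Notation Q := (null_quotient top F mu).

Lemma ble_antisym (x y : ambient Q) : elts x -> elts y -> ble x y -> ble y x -> x = y.
Proof.
move=> [A FA <-] [B FB <-] /(quotient_le P FA FB) AB /(quotient_le P FB FA) BA.
by apply/(null_classP P) => //; rewrite (alg_muY P)// AB BA addr0.
Qed.

Lemma elts_compl (x : ambient Q) : elts x -> elts (bcompl x).
Proof.
move=> [A FA <-]; rewrite (quotient_compl P)//; exists (top `\` A) => //.
exact: (alg_D P (alg_T P) FA).
Qed.

(** For a set S of fixed elements with supremum s, the image of s is again an upper bound, so s lies
    below it; applying the involution gives the reverse inequality. Infima are dual. *)
Lemma fixed_complete_subalgebra (phi : ambient Q -> ambient Q) :
  (forall x, elts x -> elts (phi x)) -> (forall x, elts x -> phi (phi x) = x) ->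
  (forall x y, elts x -> elts y -> ble x y -> ble (phi x) (phi y)) ->
  (forall x, elts x -> phi (bcompl x) = bcompl (phi x)) ->
  complete_subalgebra [set x : ambient Q | elts x /\ phi x = x].
Proof.
move=> phiE phiK phi_le phiC; split.
- by move=> x [].
- by move=> x [ex px]; split; [exact: elts_compl|rewrite phiC// px].
- move=> S s SC [es ub lub]; split=> //.
  have sp : ble s (phi s).
    apply: lub => [|x Sx]; first exact: phiE.
    by have [ex <-] := SC x Sx; apply: phi_le => //; apply: ub.
  apply: ble_antisym => //; first exact: phiE.
  by rewrite -[X in ble _ X](phiK s es); apply: phi_le => //; apply: phiE.
move=> S s SC [es lb glb]; split=> //.
have sp : ble (phi s) s.
  apply: glb => [|x Sx]; first exact: phiE.
  by have [ex <-] := SC x Sx; apply: phi_le => //; apply: lb.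
apply: ble_antisym => //; first exact: phiE.
by rewrite -[X in ble X _](phiK s es); apply: phi_le => //; apply: phiE.
Qed.

End Quotients.

Section CantorType.
Variables (R : realType) (K : choiceType).
Local Notation Z := (cantor_space K).
Local Notation "'mZ'" := (@measurable _ Z).
Local Notation lam := (@cantor_measure R K).
Local Notation B := (cantor_algebra R K).
Local Notation cl := (null_class mZ lam).
Let P := cantor_prob_algebra R K.

Definition flip_class (k : K) (x : set (set (K -> bool))) : set (set (K -> bool)) :=
  \bigcup_(A in x) cl (flip k @^-1` A).

Lemma flip_classE k A : mZ A -> flip_class k (cl A) = cl (flip k @^-1` A).
Proof.
move=> mA; apply/seteqP; split=> [C [A' [mA' AA']]|C hC]; last first.
  by exists A => //; apply: (null_class_refl P).
suff -> : cl (flip k @^-1` A') = cl (flip k @^-1` A) by [].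
apply/(null_classP P); [exact: flip_measurable..|].
rewrite -[LHS]/(lam (flip k @^-1` (A' `+` A))) flip_measure; last exact: (alg_Y P).
by rewrite setYC.
Qed.

Lemma uncountable_generators (G : set (ambient B)) : ~ countable [set: K] ->
  completely_generates G -> ~ countable G.
Proof.
move=> unc [Gelts Ggen] cG.
have /choice[J JP] (x : ambient B) : exists J, countable J /\ (G x ->
    exists A, [/\ mZ A, x = cl A & forall k, ~ J k -> flip k @^-1` A = A]).
  have [Gx|nGx] := pselect (G x); last by exists set0; split.
  have [A mA <-] := Gelts x Gx; have [J [cJ JA]] := measurable_flip_invariant mA.
  by exists J; split=> // _; exists A.
have [k nJk] : exists k, ~ (\bigcup_(x in G) J x) k.
  apply: contrapT => /forallNP allJ; apply: unc.
  apply: (@sub_countable _ _ _ (\bigcup_(x in G) J x)).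
    by apply: subset_card_le => k _; apply: contrapT; apply: allJ.
  by apply: bigcup_countable => // x _; have [] := JP x.
have flipcK (x : ambient B) : elts x -> flip_class k (flip_class k x) = x.
  move=> [A mA <-]; rewrite !flip_classE//; last exact: flip_measurable.
  congr (cl _); apply/seteqP; split=> f /=; by rewrite flipK.
have C : complete_subalgebra [set x : ambient B | elts x /\ flip_class k x = x].
  apply: (fixed_complete_subalgebra P) => //.
  - move=> _ [A mA <-]; rewrite flip_classE//; exists (flip k @^-1` A) => //.
    exact: flip_measurable.
  - move=> _ _ [A mA <-] [A' mA' <-] /(quotient_le P mA mA') AA'.
    rewrite !flip_classE//; apply/(quotient_le P); [exact: flip_measurable..|].
    by rewrite -[LHS]/(lam (flip k @^-1` (A `\` A'))) flip_measure//; exact: measurableD.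
  move=> _ [A mA <-]; rewrite (quotient_compl P)// !flip_classE//; last first.
    by apply: (alg_D P) => //; exact: measurableT.
  by rewrite (quotient_compl P)//; exact: flip_measurable.
have := Ggen _ C => /(_ _ (cl (coordinate k))) [].
- move=> x Gx; split; first exact: Gelts.
  have [_ /(_ Gx)[A [mA xE AJ]]] := JP x; rewrite xE flip_classE// AJ// => Jk.
  by apply: nJk; exists x.
- by exists (coordinate k) => //; exact: coordinate_measurable.
move=> _; rewrite flip_classE; last exact: coordinate_measurable.
move=> /(null_classP P (flip_measurable _ (coordinate_measurable k))
  (coordinate_measurable k)).
rewrite (_ : _ `+` _ = setT) ?(alg_muT P); first by move/eqP; rewrite oner_eq0.
apply/seteqP; split=> f // _; rewrite /setY /coordinate /flip /= eqxx.
by case: (f k) => /=; [right|left].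
Qed.

End CantorType.

Section Transport.
Variables (R : realType) (B1 B2 : measured_algebra R).
Hypothesis meet1 : forall x y : ambient B1, elts x -> elts y -> elts (bmeet x y).
Hypothesis compl1 : forall x : ambient B1, elts x -> elts (bcompl x).

(** A bijection commuting with meets preserves and reflects the order, hence suprema and infima, so
    complete subalgebras pull back to complete subalgebras. *)
Lemma isomorphic_generators (phi : ambient B1 -> ambient B2) G :
  set_bij (@elts _ B1) (@elts _ B2) phi ->
  (forall x y, elts x -> elts y -> phi (bmeet x y) = bmeet (phi x) (phi y)) ->
  (forall x, elts x -> phi (bcompl x) = bcompl (phi x)) ->
  completely_generates G -> completely_generates (phi @` G).
Proof.
move=> [phi_fun phi_inj phi_surj] phiI phiC [Gelts Ggen].
have phi_le x y : elts x -> elts y -> ble x y <-> ble (phi x) (phi y).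
  move=> ex ey; rewrite /ble -phiI//; split=> [->//|h].
  by apply: phi_inj h; rewrite inE//; apply: meet1.
split=> [_ [x /Gelts ex <-]|C [Celts CC Csup Cinf] GC]; first exact: phi_fun.
have imC S : S `<=` [set x | elts x /\ C (phi x)] -> phi @` S `<=` C.
  by move=> SC _ [x /SC[_ Cx] <-].
have C1 : complete_subalgebra [set x | elts x /\ C (phi x)].
  split.
  - by move=> x [].
  - by move=> x [ex Cx]; split; [exact: compl1|rewrite phiC//; apply: CC].
  - move=> S s SC [es ub lub]; split=> //; apply: (Csup (phi @` S)).
      exact: imC.
    split; first exact: phi_fun.
      by move=> _ [x Sx <-]; apply/phi_le => //; [have [] := SC x Sx|exact: ub].
    move=> u eu uub; have [v ev vu] := phi_surj u eu; rewrite -vu.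
    apply/phi_le => //; apply: lub => // x Sx; apply/phi_le => //.
      by have [] := SC x Sx.
    by rewrite vu; apply: uub; exists x.
  move=> S s SC [es lb glb]; split=> //; apply: (Cinf (phi @` S)).
    exact: imC.
  split; first exact: phi_fun.
    by move=> _ [x Sx <-]; apply/phi_le => //; [have [] := SC x Sx|exact: lb].
  move=> u eu ulb; have [v ev vu] := phi_surj u eu; rewrite -vu.
  apply/phi_le => //; apply: glb => // x Sx; apply/phi_le => //.
    by have [] := SC x Sx.
  by rewrite vu; apply: ulb; exists x.
move=> y ey; have [x ex <-] := phi_surj y ey.
have [|//] := Ggen _ C1 _ x ex.
by move=> z Gz; split; [exact: Gelts|apply: GC; exists z].
Qed.

End Transport.

(** The generating set of size omega_1 is the whole algebra: codes in M bound its size from above,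
    and the lower bound for generating sets applies to it too. *)
Lemma model_algebra_type (R : realType) (M : arith_structure) (W : M) :
  model_of_true_arithmetic M -> nonstandard W -> [set: M] #<= [set: omega1] ->
  measure_algebra_isomorphic (model_algebra R W) (cantor_algebra R omega1) ->
  maharam_type_is (model_algebra R W) omega1.
Proof.
move=> MTA Wns cardM [phi [phi_bij _ phiI phiC _]].
have P := coded_prob_algebra R MTA Wns.
have [_ unc _] := omega1P.
have lower G : completely_generates (G : set (ambient (model_algebra R W))) ->
    [set: omega1] #<= G.
  move=> Ggen; apply: uncountable_omega1_le => cG.
  have phiG : completely_generates (phi @` G).
    apply: isomorphic_generators phi_bij phiI phiC Ggen; last exact: (elts_compl P).
    move=> _ _ [A FA <-] [A' FA' <-]; rewrite (quotient_meet P)//.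
    by exists (A `&` A') => //; apply: (alg_I P).
  apply: (uncountable_generators unc phiG).
  exact: sub_countable (card_image_le _ _) cG.
split=> //; exists (@elts _ (model_algebra R W)).
have gen : completely_generates (@elts _ (model_algebra R W)) by split.
split=> //; apply/card_eqPle; split; last exact: lower.
apply: card_le_trans cardM.
have -> : @elts _ (model_algebra R W) =
    (fun a => null_class (coded_subsets W) (internal_measure R W)
       (coded_set W MTA a)) @` setT.
  apply/seteqP; split=> [_ [A /(coded_subsetsP W MTA)[a ->] <-]|_ [a _ <-]].
    by exists a.
  by exists (coded_set W MTA a) => //; apply/(coded_subsetsP W MTA); exists a.
exact: card_image_le.
Qed.

Theorem theorem5p7 (R : realType) (M : arith_structure) (Omega : M) :
  CH ->
  model_of_true_arithmetic M ->
  nonstandard_model M ->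
  omega1_saturated M ->
  [set: M] #= [set: omega1] ->
  nonstandard Omega ->
  maharam_type_is (model_algebra R Omega) omega1 /\
  measure_algebra_isomorphic (model_algebra R Omega) (cantor_algebra R omega1).
Proof.
move=> _ MTA _ Msat /card_eqPle[cardM _] Wns.
have iso := model_algebra_isomorphic R MTA Wns Msat cardM.
by split=> //; apply: model_algebra_type.
Qed.
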